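(* Let $E=\mathbb R^d$ and $I=[0,1]$. For every $t\in I$ let $A(t):D(A(t))\subset E\rightrightarrows E$ be a maximal monotone operator, and assume: (H1) there is a function $r:I\to[0,+\infty[$, right continuous on $[0,1[$ and nondecreasing, with $r(0)=0$ and $r(1)<+\infty$, such that $dis(A(t),A(s))\le dr(]s,t])=r(t)-r(s)$ for $0\le s\le t\le 1$; (H2) there is a nonnegative real constant $c$ such that $\|A^0(t,x)\|\le c(1+\|x\|)$ for all $t\in I$, $x\in D(A(t))$. Let $b:I\times E\to E$ be a $(\mathcal B(I)\otimes\mathcal B(E),\mathcal B(E))$-measurable mapping satisfying: (j) $\|b(t,x)\|\le M$ for all $(t,x)\in I\times E$, for some nonnegative constant $M$; (jj) for all $t\in I$, $b(t,\cdot)$ is continuous on $E$. Let $y_0\in D(A(0))$. Then there exist a BVRC mapping $X:I\to E$ and a BVRC mapping $Y:I\to E$ satisfying $$\begin{cases}X(0)=Y(0)=y_0;\\ X(t)=\int_0^t b(s,X(s))\,ds+Y(t)\quad\forall t\in I;\\ Y(t)\in D(A(t))\quad\forall t\in I;\\ -\frac{dY}{d\nu}(t)\in A(t)Y(t)+\Big(\int_0^t b(s,X(s))\,ds\Big)\frac{d\lambda}{d\nu}(t)\quad\nu\text{-a.e. }t\in I.\end{cases}$$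
   Context: $\lambda=ds$ is Lebesgue measure on $I$; $\mathcal B(\cdot)$ denotes Borel sigma-algebras. For a maximal monotone operator $A(t)$, $D(A(t))$ is its domain and $A^0(t,x)$ is the projection of the origin on the closed convex set $A(t)x$. The pseudo-distance between maximal monotone operators $A,B$ is $$dis(A,B)=\sup\Big\{\frac{\langle y-y',x'-x\rangle}{1+\|y\|+\|y'\|}:\ x\in D(A),\,y\in Ax,\,x'\in D(B),\,y'\in Bx'\Big\}.$$ $dr$ is the Stieltjes measure on $I$ associated with $r$ (so $dr(]s,t])=r(t)-r(s)$), $\nu:=\lambda+dr$, and $\frac{d\lambda}{d\nu}$ is the density of $\lambda$ with respect to $\nu$. BVRC means of bounded variation and right continuous. $\frac{dY}{d\nu}$ denotes the density with respect to $\nu$ of the differential measure $dY$ of $Y$ ($dY(]s,t])=Y(t)-Y(s)$), i.e. $Y(t)=Y(0)+\int_{]0,t]}\frac{dY}{d\nu}\,d\nu$; its existence is part of the conclusion. *)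

(* Defs.v *)
From HB Require Import structures.
From mathcomp Require Import all_boot all_order all_algebra.
From mathcomp Require Import all_classical all_reals all_analysis.

Set Implicit Arguments.
Unset Strict Implicit.
Unset Printing Implicit Defensive.
Import Order.TTheory GRing.Theory Num.Theory.
Import numFieldNormedType.Exports.
Local Open Scope classical_set_scope.
Local Open Scope ring_scope.

(* Throughout, functions on I = [0, 1] are functions on R of which only the
   values on [0, 1] matter, and E = R^d is 'rV[R]_d.  The library norm on
   'rV[R]_d is the max norm (same topology), so the Euclidean norm is defined
   separately. *)

Section euclidean.
Context {R : realType} {d : nat}.
Implicit Types x y : 'rV[R]_d.

Definition dotp x y : R := \sum_(i < d) x 0 i * y 0 i.

Definition enorm x : R := Num.sqrt (dotp x x).

Definition is_proj (C : set 'rV[R]_d) x y : Prop :=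
  C y /\ forall z, C z -> enorm (x - y) <= enorm (x - z).

(* Total: the value is the dummy 0 when C has no point nearest to x, which
   does not happen for C nonempty, closed and convex. *)
Definition proj (C : set 'rV[R]_d) x : 'rV[R]_d := xget 0 (is_proj C x).

End euclidean.

Section operators.
Context {R : realType} {d : nat}.
Local Notation E := 'rV[R]_d.
Implicit Types A B : E -> set E.

Definition dom A : set E := [set x | A x !=set0].

Definition monotone A : Prop :=
  forall x x' y y', A x y -> A x' y' -> 0 <= dotp (y - y') (x - x').

Definition maximal_monotone A : Prop :=
  monotone A /\
  forall B, monotone B -> (forall x, A x `<=` B x) -> forall x, B x `<=` A x.

(* A^0(x), the element of A x of least norm. *)
Definition min_section A (x : E) : E := proj (A x) 0.

Definition dis A B : \bar R :=
  ereal_sup [set q | exists x y x' y',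
    [/\ dom A x, A x y, dom B x', B x' y' &
        q = (dotp (y - y') (x' - x) / (1 + enorm y + enorm y'))%:E]].

End operators.

Definition borelType (T : ptopologicalType) := g_sigma_algebraType (@open T).

(* Lebesgue integral of a vector-valued function, componentwise. *)
Definition vintegral {R : realType} {d : nat}
    (mu : {measure set (measurableTypeR R) -> \bar R})
    (D : set R) (f : R -> 'rV[R]_d) : 'rV[R]_d :=
  \row_(i < d) \int[mu]_(s in D) f s 0 i.

Section BVRC.
Context {R : realType} {d : nat}.
Implicit Types f : R -> 'rV[R]_d.

(* Vector-valued analogue of [variation 0 1 f s]. *)
Definition vvariation f (s : seq R) : R :=
  let F := f \o nth 1 (0 :: s) in
  \sum_(0 <= n < size s) enorm (F n.+1 - F n).

Definition BVRC f : Prop :=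
  (exists V : R, forall s, itv_partition 0 1 s -> vvariation f s <= V) /\
  (forall t : R, t \in `[0, 1[ -> f x @[x --> t^'+] --> f t).

End BVRC.

(* The Stieltjes measure on [0, 1] of a function r that is nondecreasing on
   [0, 1] and right continuous on [0, 1[.  To use the library's
   Lebesgue-Stieltjes measure, r is extended by r 0 on the left of 0 and by r 1
   on the right of 1; in particular {0} has measure 0 and {1} has measure
   r 1 - r 1^-. *)
Section stieltjes.
Context {R : realType} (r : R -> R).
Hypothesis rnd : {in `[0, 1] &, {homo r : s t / s <= t}}.
Hypothesis rrc : forall t : R, t \in `[0, 1[ -> r x @[x --> t^'+] --> r t.

Definition clamp01 (x : R) : R := Num.min 1 (Num.max 0 x).

Lemma clamp01_in x : clamp01 x \in `[0, 1].
Proof. by rewrite in_itv/= le_min ler01 le_max lexx/= ge_min lexx. Qed.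

Lemma le_clamp01 : {homo clamp01 : x y / x <= y}.
Proof.
by move=> x y xy; rewrite /clamp01 le_min !ge_min !ge_max !le_max !lexx xy !orbT.
Qed.

Lemma clamp01_id x : x \in `[0, 1] -> clamp01 x = x.
Proof. by rewrite in_itv/= => /andP[x0 x1]; rewrite /clamp01 max_r// min_r. Qed.

Definition clamp_ext
  of {in `[0, 1] &, {homo r : s t / s <= t}}
  & (forall t : R, t \in `[0, 1[ -> r x @[x --> t^'+] --> r t) : R -> R :=
  r \o clamp01.

Local Notation rext := (clamp_ext rnd rrc).

Let rext_nd : nondecreasing rext.
Proof.
by move=> x y xy; apply: rnd; rewrite ?clamp01_in//; exact: le_clamp01.
Qed.

Let rext_rc (x : R) : rext @ x^'+ --> rext x.
Proof.
have [x0|x0] := ltP x 0.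
  apply: cvg_near_cst; near=> y.
  have y0 : y < 0 by near: y; exact: nbhs_right_lt.
  by rewrite /clamp_ext /= /clamp01 !max_l// ltW.
have [x1|x1] := leP 1 x.
  apply: cvg_near_cst; near=> y.
  have xy : x < y by near: y; exact: nbhs_right_gt.
  have y1 : 1 <= y by rewrite (le_trans x1)// ltW.
  by rewrite /clamp_ext /= /clamp01 !max_r// ?min_l// (le_trans x0)// ltW.
rewrite {2}/clamp_ext /= clamp01_id ?in_itv/= ?x0 ?ltW//.
apply: cvg_trans (rrc _); last by rewrite in_itv/= x0.
apply: near_eq_cvg; near=> y.
have xy : x < y by near: y; exact: nbhs_right_gt.
have y1 : y < 1 by near: y; exact: nbhs_right_lt.
rewrite /clamp_ext /= clamp01_id// in_itv/= (ltW y1) andbT.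
by rewrite (le_trans x0)// ltW.
Unshelve. all: by end_near. Qed.

HB.instance Definition _ := isCumulative.Build R _ R rext rext_nd rext_rc.

Definition dr : set (measurableTypeR R) -> \bar R :=
  lebesgue_stieltjes_measure rext.
HB.instance Definition _ := Measure.on dr.

Lemma dr_itvoc s t : 0 <= s -> s <= t -> t <= 1 ->
  dr `]s, t]%classic = (r t - r s)%:E.
Proof.
move=> s0 st t1; rewrite /dr /lebesgue_stieltjes_measure /measure_extension/=.
rewrite measurable_mu_extE/=; last exact: is_ocitv.
rewrite wlength_itv_bnd// /clamp_ext/= !clamp01_id// in_itv/=.
  by rewrite s0 (le_trans st).
by rewrite t1 (le_trans s0).
Qed.

Local Notation I01 := (`[(0 : R), 1]%classic : set (measurableTypeR R)).

Let measurable_I01 : measurable I01.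
Proof. exact: measurable_itv. Qed.

Let lebesgue_I01_fin : (lebesgue_measure I01 < +oo)%E.
Proof. by rewrite lebesgue_measure_itv/= lte_fin ltr01 -EFinB ltry. Qed.

Let dr_I01_fin : (dr I01 < +oo)%E.
Proof.
apply: (@le_lt_trans _ _ (dr `](-1), 1]%classic)).
  apply: le_measure; rewrite ?inE//=.
  by apply: subset_itvr; rewrite bnd_simp ltrN10.
rewrite /dr /lebesgue_stieltjes_measure /measure_extension/=.
rewrite measurable_mu_extE/=; last exact: is_ocitv.
by rewrite wlength_itv_bnd ?ltry// (le_trans lerN10).
Qed.

Definition lambdaI := mfrestr measurable_I01 lebesgue_I01_fin.
HB.instance Definition _ := FiniteMeasure.on lambdaI.

Definition drI := mfrestr measurable_I01 dr_I01_fin.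
HB.instance Definition _ := FiniteMeasure.on drI.

Definition nu := measure_add lambdaI drI.
HB.instance Definition _ := Measure.on nu.

Let nu_fin : fin_num_fun nu.
Proof.
move=> X mX; rewrite [X in X \is a _](measure_addE lambdaI drI).
by rewrite fin_numD !fin_num_measure.
Qed.

HB.instance Definition _ := Measure_isFinite.Build _ _ _ nu nu_fin.

(* Hence the Radon-Nikodym derivative below is the genuine, finite, one. *)
Lemma lambdaI_dominated : charge_of_finite_measure lambdaI `<< nu.
Proof.
apply/null_content_dominatesP => X mX.
rewrite [X in X = 0%E -> _](measure_addE lambdaI drI) => /eqP.
by rewrite padde_eq0 ?measure_ge0// => /andP[/eqP].
Qed.

Local Open Scope charge_scope.
Definition dlambda_dnu (t : R) : R :=
  fine (('d (charge_of_finite_measure lambdaI) '/d nu) t).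

(* g is a nu-density of the differential measure of Y, characterised by
   dY(]s, t]) = Y t - Y s. *)
Definition is_density {d : nat} (Y g : R -> 'rV[R]_d) : Prop :=
  (forall i, nu.-integrable `[0, 1]%classic (fun s => (g s 0 i)%:E)) /\
  (forall t, t \in `[0, 1] -> Y t = Y 0 + vintegral nu `]0, t]%classic g).

End stieltjes.

(* Main.v *)
Require Import Defs.
From mathcomp Require Import all_boot all_order all_algebra.
From mathcomp Require Import all_classical all_reals all_analysis.
From mathcomp Require Import measurable_realfun ring lra.

Set Implicit Arguments.
Unset Strict Implicit.
Unset Printing Implicit Defensive.
Import Order.TTheory GRing.Theory Num.Theory.
Import numFieldNormedType.Exports.
Local Open Scope classical_set_scope.
Local Open Scope ring_scope.

(** With [phi t = t + r t], the distribution function of [nu], choose nodes [t k]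
    such that [phi] varies by at most [eps] on each [t k, t k.+1[ and run the
    implicit scheme
      [Y k.+1 = Y k - (phi (t k.+1) - phi (t k)) a k.+1 - (t k.+1 - t k) B k],
      [a k.+1 \in A (t k.+1) (Y k.+1)],
    where [B] integrates [b] along [B + Y], frozen at the left node of each cell;
    by Minty's theorem each step is solvable.  Testing the monotonicity of the
    pair [A (t k)], [A (t k.+1)] on the minimal section [A^0 (t k, Y k)] bounds
    [a k.+1] by [c (1 + |Y k|)] plus a constant, so all [a k] are bounded.
    Hence [B] and [Q = Y + \int B] are Lipschitz with respect to [phi] up to
    an error [eps], and a subsequence converges uniformly; no fixed point theorem
    is needed because the scheme is explicit in [b].  Mazur's lemma in [L^2(nu)]
    gives convex combinations of the step functions [a] that converge
    [nu]-almost everywhere, and the limit lies in [A t (Y t)] by maximality,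
    since the inequalities expressing monotonicity are affine in [a]. *)

(** * Euclidean space *)

(** The steps are weighted by increments of [phi] because such an increment dominates both that of
    [r], which controls [dis], and that of time, which controls the drift: on division by it both
    errors stay bounded. A jump of [r] is thus crossed in a single implicit step with a bounded [a],
    the value of a density on an atom of [nu]. The function [Q] isolates the multivalued part:
    [dQ = - a dnu], while the drift is a Lebesgue integral. Compactness is therefore sought for the
    pair [(B, Q)], from which [Y = Q - \int B] and [X = B + Y] are recovered. The implicit values
    [a] sit at right nodes and are spread over cells closed on the right, as suits [nu] of []s, t]];
    the explicit values sit at left nodes and are spread over cells closed on the left. Hence the
    approximate velocity at [s] lies in the operator at a later node, and right continuity of [r] is
    what removes this shift in the limit. The velocities are merely bounded, so no pointwise limit
    of them is available on a set of positive measure without convex combinations. *)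

Section euclidean_theory.
Context {R : realType} {d : nat}.
Implicit Types (x y z : 'rV[R]_d) (a : R).

Lemma dotpC x y : dotp x y = dotp y x.
Proof. by apply: eq_bigr => i _; rewrite mulrC. Qed.

Lemma dotpDl x y z : dotp (x + y) z = dotp x z + dotp y z.
Proof.
by rewrite -big_split/=; apply: eq_bigr => i _; rewrite mxE mulrDl.
Qed.

Lemma dotpZl a x y : dotp (a *: x) y = a * dotp x y.
Proof. by rewrite mulr_sumr; apply: eq_bigr => i _; rewrite mxE mulrA. Qed.

Lemma dotpNl x y : dotp (- x) y = - dotp x y.
Proof. by rewrite -scaleN1r dotpZl mulN1r. Qed.

Lemma dotpDr x y z : dotp z (x + y) = dotp z x + dotp z y.
Proof. by rewrite !(dotpC z) dotpDl. Qed.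

Lemma dotpZr a x y : dotp y (a *: x) = a * dotp y x.
Proof. by rewrite !(dotpC y) dotpZl. Qed.

Lemma dotpNr x y : dotp y (- x) = - dotp y x.
Proof. by rewrite !(dotpC y) dotpNl. Qed.

Definition dotpE := (dotpDl, dotpDr, dotpNl, dotpNr, dotpZl, dotpZr).

Lemma dotp0l y : dotp 0 y = 0.
Proof. by rewrite -(scale0r 0) dotpZl mul0r. Qed.

Lemma dotp_ge0 x : 0 <= dotp x x.
Proof. by apply: sumr_ge0 => i _; rewrite -expr2 sqr_ge0. Qed.

Lemma enorm_ge0 x : 0 <= enorm x. Proof. exact: sqrtr_ge0. Qed.

Lemma sqr_enorm x : enorm x ^+ 2 = dotp x x.
Proof. by rewrite sqr_sqrtr// dotp_ge0. Qed.

Lemma enorm0 : enorm (0 : 'rV[R]_d) = 0.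
Proof. by rewrite /enorm dotp0l sqrtr0. Qed.

Lemma enormZ a x : enorm (a *: x) = `|a| * enorm x.
Proof. by rewrite /enorm dotpZl dotpZr mulrA -expr2 sqrtrM ?sqr_ge0// sqrtr_sqr. Qed.

Lemma enormN x : enorm (- x) = enorm x.
Proof. by rewrite -scaleN1r enormZ normrN1 mul1r. Qed.

Lemma enormBC x y : enorm (x - y) = enorm (y - x).
Proof. by rewrite -opprB enormN. Qed.

Lemma le_enorm_sqr x a : 0 <= a -> dotp x x <= a ^+ 2 -> enorm x <= a.
Proof.
move=> a0 h; rewrite /enorm -(ger0_norm a0) -sqrtr_sqr; exact: ler_wsqrtr.
Qed.

(** Cauchy-Schwarz: with [p = |x|] and [q = |y|], [|q x - p y|^2 = 2 p q (p q - <x, y>)]; if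
    [p q = 0], one of the vectors vanishes. *)
Lemma dotp_le x y : dotp x y <= enorm x * enorm y.
Proof.
set p := enorm x; set q := enorm y.
have p0 : 0 <= p := enorm_ge0 x; have q0 : 0 <= q := enorm_ge0 y.
have := dotp_ge0 (q *: x - p *: y).
rewrite !dotpE -!sqr_enorm -/p -/q (dotpC y x) => h.
have [pq0|] := ltP 0 (p * q); first by nra.
rewrite le_eqVlt ltNge mulr_ge0// orbF => /eqP /[dup] pq0 ->.
have {h} x0y0 : p = 0 \/ q = 0.
  by move/eqP : pq0; rewrite mulf_eq0 => /orP[/eqP|/eqP]; [left|right].
have nul z : enorm z = 0 -> forall i, z 0 i = 0.
  move=> z0 i; have := sqr_enorm z; rewrite z0 expr0n/= => /esym/eqP.
  rewrite psumr_eq0; last by move=> j _; rewrite -expr2 sqr_ge0.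
  by move=> /allP/(_ i); rewrite mem_index_enum => /(_ isT); rewrite -expr2 sqrf_eq0 => /eqP.
rewrite /dotp big1// => i _.
by case: x0y0 => /nul ->; rewrite ?mul0r ?mulr0.
Qed.

Lemma ler_enormD x y : enorm (x + y) <= enorm x + enorm y.
Proof.
apply: le_enorm_sqr; first by rewrite addr_ge0 ?enorm_ge0.
rewrite !dotpE -!sqr_enorm (dotpC y x); have := dotp_le x y; nra.
Qed.

Lemma ler_enormB x y : enorm (x - y) <= enorm x + enorm y.
Proof. by rewrite -(enormN y) ler_enormD. Qed.

Lemma ler_enorm_distD y x z : enorm (x - z) <= enorm (x - y) + enorm (y - z).
Proof. by apply: le_trans (ler_enormD _ _); rewrite subrKA. Qed.

Lemma norm_dotp_le x y : `|dotp x y| <= enorm x * enorm y.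
Proof.
by rewrite ler_norml dotp_le andbT lerNl -dotpNl -(enormN x) dotp_le.
Qed.

Lemma coord_le_enorm x i : `|x 0 i| <= enorm x.
Proof.
rewrite /enorm -sqrtr_sqr ler_wsqrtr// /dotp (bigD1 i)//= -expr2 lerDl.
by apply: sumr_ge0 => j _; rewrite -expr2 sqr_ge0.
Qed.

Lemma enorm_le_sum x : enorm x <= \sum_(i < d) `|x 0 i|.
Proof.
have -> : x = \sum_(i < d) x 0 i *: delta_mx 0 i.
  by rewrite [LHS]matrix_sum_delta big_ord1.
have -> : \sum_(i < d) `|(\sum_(j < d) x 0 j *: delta_mx 0 j : 'rV_d) 0 i| =
    \sum_(i < d) `|x 0 i|.
  apply: eq_bigr => i _; rewrite summxE (bigD1 i)//= big1 ?addr0.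
    by rewrite !mxE !eqxx mulr1.
  by move=> j ji; rewrite !mxE eqxx/= eq_sym (negbTE ji) mulr0.
elim/big_ind2 : _ => [|u p v q up vq|i _]; first by rewrite enorm0.
  by rewrite (le_trans (ler_enormD _ _))// lerD.
rewrite enormZ ler_piMr// le_enorm_sqr// expr1n /dotp (bigD1 i)//= big1.
  by rewrite !mxE !eqxx mulr1 addr0.
by move=> j ji; rewrite !mxE eqxx/= (negbTE ji) mul0r.
Qed.

Lemma enorm_le_coord x a : (forall i, `|x 0 i| <= a) -> enorm x <= d%:R * a.
Proof.
move=> xa; apply: (le_trans (enorm_le_sum x)).
by rewrite (le_trans (ler_sum _ (fun i _ => xa i)))// sumr_const card_ord mulr_natl.
Qed.

Lemma enorm_eq0 x : enorm x <= 0 -> x = 0.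
Proof.
move=> x0; apply/rowP => i; rewrite mxE; apply/eqP; rewrite -normr_le0.
exact: le_trans (coord_le_enorm x i) x0.
Qed.

End euclidean_theory.

(** Tychonoff's theorem on a product of segments gives a cluster point in the product topology,
    whose neighbourhoods control finitely many coordinates. A cluster point is used instead of a
    convergent subsequence because the index type may be uncountable, as in
    [uniform_subsequence]. *)
Lemma bounded_cluster {R : realType} (I : eqType) (f : nat -> I -> R) (C : I -> R) :
  (forall n i, `|f n i| <= C i) ->
  exists g : I -> R, forall (s : seq I) e N, 0 < e ->
    exists2 n, (N <= n)%N & forall i, i \in s -> `|f n i - g i| < e.
Proof.
move=> fC.
pose K : set (I -> R) := [set h | forall i, `[- C i, C i]%classic (h i)].
have cK : @compact (prod_topology _) K.
  apply: (@tychonoff I (fun=> R) (fun i => `[- C i, C i]%classic)) => i.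
  exact: segment_compact.
have [|g [_ clg]] := cK (f @ \oo) _.
  by exists 0 => // n _ i; rewrite /= in_itv/= -ler_norml.
exists g => s e N e0.
pose A : set (I -> R) := [set h | exists2 n, (N <= n)%N & h = f n].
pose B : set (prod_topology (fun _ : I => R)) :=
  [set h | forall i, i \in s -> `|h i - g i| < e].
have : A `&` B !=set0.
  apply: clg; first by exists N => // n Nn; exists n.
  rewrite /B; elim: s {B} => [|i s IH].
    by apply: filterS filterT => h _ j.
  have : nbhs (g : prod_topology (fun _ : I => R)) [set h | `|h i - g i| < e].
    apply: (@proj_continuous I (fun=> R) i g [set y | `|y - g i| < e]).
    apply: filterS (nbhsx_ballx (g i) e e0) => y /=.
    by rewrite -ball_normE/= distrC.
  apply: filterS2 IH => h IH hi j; rewrite inE => /orP[/eqP ->//|]; exact: IH.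
by move=> [_ [[n Nn ->] fB]]; exists n.
Unshelve. all: by end_near. Qed.

Lemma bounded_enorm_cluster {R : realType} {d : nat} (u : nat -> 'rV[R]_d) (C : R) :
  (forall n, enorm (u n) <= C) ->
  exists l, forall e N, 0 < e -> exists2 n, (N <= n)%N & enorm (u n - l) <= e.
Proof.
move=> uC; have [|g gP] := @bounded_cluster R 'I_d (fun n => u n 0) (fun=> C).
  by move=> n i; exact: le_trans (coord_le_enorm _ _) (uC n).
exists (\row_i g i) => e N e0.
(* Dividing by [d.+1] instead of [d] covers dimension 0. *)
have e'0 : 0 < e / d.+1%:R by rewrite divr_gt0.
have [n Nn nP] := gP (enum 'I_d) _ N e'0; exists n => //.
apply: le_trans (enorm_le_coord _) _.
  by move=> i; rewrite !mxE; apply/ltW/nP; rewrite mem_enum.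
rewrite mulrCA ler_piMr ?(ltW e0)// ler_pdivrMr// mul1r ler_nat//.
Qed.

(** * Maximal monotone operators *)

Lemma ge0_of_eps {R : realFieldType} (a K : R) : 0 <= K ->
  (forall e, 0 < e -> - (e * K) <= a) -> 0 <= a.
Proof.
move=> K0 aK; apply/ler_addgt0Pr => e e0.
have K1 : 0 < K + 1 by rewrite ltr_wpDl.
have := aK (e / (K + 1)) (divr_gt0 e0 K1).
have : e / (K + 1) * K <= e by rewrite mulrAC ler_pdivrMr// ler_pM2l// lerDl.
lra.
Qed.

Section maximal_monotone_theory.
Context {R : realType} {d : nat}.
Local Notation E := 'rV[R]_d.
Implicit Types (A : E -> set E) (x y u v : E).

(** Adding the single pair [(x, y)] to the graph keeps it monotone, so maximality forces the pair to
    be there already. *)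
Lemma maximal_monotone_mem A x y : maximal_monotone A ->
  (forall u v, A u v -> 0 <= dotp (y - v) (x - u)) -> A x y.
Proof.
move=> [Am Amax] xyA; apply: (Amax (fun z w => A z w \/ (z = x /\ w = y))).
- move=> z z' w w' [zw|[-> ->]] [zw'|[-> ->]].
  + exact: Am.
  + by rewrite -opprB dotpNl -dotpNr opprB; exact: xyA.
  + exact: xyA.
  + by rewrite !subrr dotp0l.
- by move=> z w; left.
- by right.
Qed.

(** On an empty graph the test of [maximal_monotone_mem] holds vacuously at [(0, 0)]. *)
Lemma maximal_monotone_inhabited A : maximal_monotone A -> exists x y, A x y.
Proof.
move=> mA; apply: contrapT => noA; apply: (noA); exists 0, 0.
by apply: maximal_monotone_mem => // u v uv; exfalso; apply: noA; exists u, v.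
Qed.

(** * Minty's theorem, by a variational argument on the convex hull of the graph *)

Section minty.
Variable G : E -> set E.

(* The convex hull in E x E x R of the points (u, v, <u, v>), (u, v) in G. *)
Inductive graph_hull : E -> E -> R -> Prop :=
| hull_graph u v : G u v -> graph_hull u v (dotp u v)
| hull_conv t u v w u' v' w' : 0 <= t <= 1 ->
    graph_hull u v w -> graph_hull u' v' w' ->
    graph_hull ((1 - t) *: u + t *: u') ((1 - t) *: v + t *: v')
      ((1 - t) * w + t * w').

(* Affine in each of the two hull points, hence inherited from pairs of G. *)
Lemma graph_hull_monotone : Defs.monotone G -> forall u v w u' v' w',
  graph_hull u v w -> graph_hull u' v' w' ->
  0 <= w + w' - dotp u v' - dotp u' v.
Proof.
move=> mG u v w u' v' w' h h'.
elim: h => {u v w} [u v uv|t u v w u1 v1 w1 /andP[t0 t1] _ IH _ IH1].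
  elim: h' => {u' v' w'} [u' v' uv'|t u' v' w' u1 v1 w1 /andP[t0 t1] _ IH _ IH1].
    by have := mG _ _ _ _ uv uv'; rewrite !dotpE (dotpC v u) (dotpC v u') (dotpC v' u) (dotpC v' u'); lra.
  rewrite !dotpE; nra.
rewrite !dotpE; nra.
Qed.

(* The infimum over x of |x|^2 + <x, v - u> - w, attained at (u - v) / 2. *)
Let psi u v w : R := - (dotp (u - v) (u - v)) / 4 - w.

(* Along a sequence maximizing psi over the hull, (u - v) / 2 is bounded; moving
   from the hull towards (u, v) in G shows that a cluster point z satisfies
   <z + v, z - u> <= sup psi <= 0, so that (z, -z) is in G by maximality. *)
Lemma minty_origin : Defs.monotone G ->
  (forall x y, (forall u v, G u v -> 0 <= dotp (y - v) (x - u)) -> G x y) ->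
  (exists x y, G x y) -> exists x, G x (- x).
Proof.
move=> mG Gmax [u0 [v0 uv0]].
(* [graph_hull_monotone] at a point and itself gives [w >= <u, v>], hence
   [psi u v w <= - |u + v|^2 / 4]. *)
have psi_le0 u v w : graph_hull u v w -> psi u v w <= 0.
  move=> h; have := graph_hull_monotone mG h h.
  by have := dotp_ge0 (u + v); rewrite /psi !dotpE (dotpC v u); lra.
pose V := [set psi p.1.1 p.1.2 p.2 | p in [set p | graph_hull p.1.1 p.1.2 p.2]].
pose p0 := psi u0 v0 (dotp u0 v0).
have V0 : V p0 by exists (u0, v0, dotp u0 v0) => //=; exact: hull_graph.
have supV : has_sup V.
  by split; [exists p0|exists 0 => _ [p /= hp <-]; exact: psi_le0].
pose S := sup V.
have psi_le u v w : graph_hull u v w -> psi u v w <= S.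
  by move=> h; apply: (sup_upper_bound supV); exists (u, v, w).
have /choice[h hP] : forall n : nat, exists p, graph_hull p.1.1 p.1.2 p.2 /\
    S - n.+1%:R^-1 < psi p.1.1 p.1.2 p.2.
  move=> n; have e0 : 0 < n.+1%:R^-1 :> R by rewrite invr_gt0.
  by have [_ [p hp <-] ltp] := sup_adherent e0 supV; exists p.
clearbody S.
pose x n : E := 2^-1 *: ((h n).1.1 - (h n).1.2).
pose x0 : E := 2^-1 *: (u0 - v0).
(* As [psi] is [- |x|^2 - w] with [x = (u - v) / 2], its value at the midpoint with the reference
   point is the mean of the two values plus [|x n - x0|^2 / 4], and it is at most [S]. *)
have xx0 n : dotp (x n - x0) (x n - x0) <= 4 * S - 2 * p0 - 2 * (S - 1).
  have [hn psin] := hP n.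
  have n1 : n.+1%:R^-1 <= 1 :> R by rewrite invf_le1// ler1n.
  have {n1}psin : S - 1 < psi (h n).1.1 (h n).1.2 (h n).2.
    by apply: le_lt_trans psin; rewrite lerD2l lerN2.
  have t01 : 0 <= (2^-1 : R) <= 1 by lra.
  have := psi_le _ _ _ (hull_conv t01 hn (hull_graph uv0)).
  move: psin; rewrite /x /x0 /p0 /psi.
  set u := (h n).1.1; set v := (h n).1.2; set w := (h n).2.
  rewrite !dotpE (dotpC v u) (dotpC u0 u) (dotpC v0 v) (dotpC v0 u) (dotpC u0 v)
    (dotpC v0 u0).
  lra.
pose C := enorm x0 + (4 * S - 2 * p0 - 2 * (S - 1) + 1).
have xC n : enorm (x n) <= C.
  have -> : x n = x0 + (x n - x0) by rewrite addrC subrK.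
  apply: le_trans (ler_enormD _ _) _; rewrite lerD2l.
  have := xx0 n; have := dotp_ge0 (x n - x0); rewrite -!sqr_enorm.
  have := enorm_ge0 (x n - x0); nra.
have [z zP] := bounded_enorm_cluster xC.
exists z; apply: Gmax => u v uv; rewrite leNgt; apply/negP => neg.
pose q y := dotp (y + v) (y - u).
pose eta := q z.
have eta0 : 0 < eta by move: neg; rewrite /eta /q !dotpE; lra.
pose y : E := 2^-1 *: (u - v).
have C0 : 0 <= C := le_trans (enorm_ge0 _) (xC 0%N).
pose Cy := (C + enorm y) ^+ 2.
have Cy0 : 0 <= Cy by rewrite sqr_ge0.
have xy n : dotp (x n - y) (x n - y) <= Cy.
  have : enorm (x n - y) <= C + enorm y.
    by rewrite (le_trans (ler_enormB _ _))// lerD2r.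
  rewrite -sqr_enorm /Cy; have := enorm_ge0 (x n - y); nra.
have qxn t n : 0 < t -> t <= 1 -> t * (q (x n) - t * Cy) <= n.+1%:R^-1.
  move=> t0 t1; have [hn psin] := hP n.
  have t01 : 0 <= t <= 1 by rewrite ltW.
  have := psi_le _ _ _ (hull_conv t01 hn (hull_graph uv)).
  have : t * psi (h n).1.1 (h n).1.2 (h n).2 <= 0.
    by rewrite pmulr_rle0// psi_le0.
  have : t * t * dotp (x n - y) (x n - y) <= t * t * Cy.
    by rewrite ler_pM2l ?mulr_gt0.
  move: psin; rewrite /q /psi /x /y; move: (_^-1 : R) => e.
  set a := (h n).1.1; set b := (h n).1.2; set w := (h n).2.
  rewrite !dotpE (dotpC b a) (dotpC u a) (dotpC v a) (dotpC u b) (dotpC v b)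
    (dotpC v u).
  lra.
clearbody x.
(* This [t] makes [t Cy <= eta / 4] even if [Cy = 0]. For large [n] it follows that
   [q (x n) <= eta / 2], and closeness of [x n] to [z] costs another [eta / 4], contradicting
   [q z = eta]. *)
have t0 : 0 < eta / (4 * (Cy + eta)) by rewrite divr_gt0// mulr_gt0// ltr_wpDl.
have tC : eta / (4 * (Cy + eta)) * Cy <= eta / 4.
  by rewrite mulrAC ler_pdivrMr ?mulr_gt0 ?ltr_wpDl//; nra.
have t1 : eta / (4 * (Cy + eta)) <= 1.
  by rewrite ler_pdivrMr ?mulr_gt0 ?ltr_wpDl//; lra.
move: t0 tC t1; set t := eta / _ => t0 tC t1.
(* A Lipschitz constant for [q] between [x n] and [z] at distance at most 1: the final 1 absorbs the
   quadratic term. *)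
pose K := 2 * C + enorm (u - v) + 1.
have K0 : 0 < K by rewrite ltr_wpDl// addr_ge0 ?enorm_ge0// mulr_ge0.
pose N := Num.truncn ((t * (eta / 4))^-1).
have te0 : 0 < t * (eta / 4) by rewrite mulr_gt0// divr_gt0.
pose dl := Num.min 1 (eta / (4 * K)).
have dl0 : 0 < dl by rewrite lt_min ltr01 divr_gt0// mulr_gt0.
have [n Nn xnz] := zP dl N dl0.
have en : n.+1%:R^-1 <= t * (eta / 4).
  rewrite -[leRHS]invrK lef_pV2 ?posrE ?invr_gt0//.
  apply: le_trans (ltW (truncnS_gt _)) _; rewrite ler_nat//.
have qn : q (x n) <= eta / 4 + eta / 4.
  have := le_trans (qxn t n t0 t1) en; rewrite ler_pM2l//; lra.
have dK : enorm (x n - z) * K <= eta / 4.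
  apply: (@le_trans _ _ (eta / (4 * K) * K)).
    by rewrite ler_pM2r// (le_trans xnz)// ge_min lexx orbT.
  by rewrite invfM mulrA mulfVK// gt_eqF.
have d1 : enorm (x n - z) <= 1 by rewrite (le_trans xnz)// ge_min lexx.
have : q z <= q (x n) + enorm (x n - z) * K.
  have : q z = q (x n) - 2 * dotp (x n) (x n - z) + dotp (x n - z) (x n - z)
      + dotp (x n - z) (u - v).
    rewrite /q !dotpE (dotpC (x n) z) (dotpC v (x n)) (dotpC v z).
    lra.
  have := dotp_le (x n - z) (u - v).
  have := norm_dotp_le (x n) (x n - z); rewrite ler_norml => /andP[+ _].
  rewrite -(sqr_enorm (x n - z)).
  have := xC n; have := enorm_ge0 (x n - z); have := enorm_ge0 (u - v).
  rewrite /K; nra.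
rewrite -/eta; lra.
Qed.

End minty.

(** Surjectivity of the identity plus [l A]: [minty_origin] is applied to the graph translated by
    [z] and rescaled by [l], which inherits maximal monotonicity. *)
Lemma minty A (z : E) l : maximal_monotone A -> 0 < l ->
  exists x y, A x y /\ x + l *: y = z.
Proof.
move=> mA l0.
have l1 : l^-1 * l = 1 by rewrite mulVf// gt_eqF.
have [|x y xyG||x Gx] := @minty_origin (fun x y => A (z + x) (l^-1 *: y)).
- move=> x x' y y' /= xy xy'; have := mA.1 _ _ _ _ xy xy'.
  rewrite opprD addrACA subrr add0r -scalerBr dotpZl pmulr_rge0// invr_gt0//.
- apply: maximal_monotone_mem => // u v uv.
  have := xyG (u - z) (l *: v).
  rewrite scalerA l1 scale1r addrC subrK => /(_ uv).
  have -> : y - l *: v = l *: (l^-1 *: y - v).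
    by rewrite scalerBr scalerA mulrC l1 scale1r.
  by rewrite dotpZl pmulr_rge0// opprB addrA (addrC x z).
- have [u [v uv]] := maximal_monotone_inhabited mA.
  by exists (u - z), (l *: v); rewrite scalerA l1 scale1r addrC subrK.
- exists (z + x), (l^-1 *: - x); split => //.
  by rewrite scalerA mulrC l1 scale1r addrK.
Qed.

(** A minimizing sequence in [A x] has a cluster point, which remains in [A x] because the
    inequalities of [maximal_monotone_mem] are closed in [y]. So [proj] returns a nearest point and
    not its default value. *)
Lemma min_section_mem A x : maximal_monotone A -> dom A x ->
  A x (min_section A x).
Proof.
move=> mA [y1 xy1]; rewrite /min_section /proj.
suff /(xgetPex 0)[] : exists y, is_proj (A x) 0 y by [].
pose V := [set enorm y | y in A x].
have infV : has_inf V.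
  split; first by exists (enorm y1), y1.
  by exists 0 => _ [y _ <-]; exact: enorm_ge0.
have /choice[y yP] : forall n : nat, exists y, A x y /\
    enorm y < inf V + n.+1%:R^-1.
  move=> n; have e0 : 0 < n.+1%:R^-1 :> R by rewrite invr_gt0.
  by have [_ [p hp <-] ltp] := inf_adherent e0 infV; exists p.
have yC n : enorm (y n) <= inf V + 1.
  apply: le_trans (ltW (yP n).2) _; rewrite lerD2l.
  by rewrite invf_le1// ler1n.
have [z zP] := bounded_enorm_cluster yC.
exists z; split.
  apply: maximal_monotone_mem => // u v uv.
  apply: (@ge0_of_eps _ _ (enorm (x - u))); first exact: enorm_ge0.
  move=> e e0; have [n _ nz] := zP e 0 e0.
  have := mA.1 _ _ _ _ (yP n).1 uv.
  have : dotp (y n - z) (x - u) <= e * enorm (x - u).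
    by rewrite (le_trans (dotp_le _ _))// ler_wpM2r// enorm_ge0.
  rewrite !dotpDl !dotpNl; lra.
move=> w xw; rewrite !sub0r !enormN; apply/ler_addgt0Pr => e e0.
have e20 : 0 < e / 2 by rewrite divr_gt0.
have [n] := zP (e / 2) (Num.truncn (e / 2)^-1) e20.
rewrite -ltnS => Nn nz.
have en : n.+1%:R^-1 <= e / 2.
  rewrite -[leRHS]invrK lef_pV2 ?posrE ?invr_gt0//.
  apply: le_trans (ltW (truncnS_gt _)) _; rewrite ler_nat//.
have -> : z = y n - (y n - z) by rewrite opprB addrC subrK.
apply: le_trans (ler_enormB _ _) _.
have := (yP n).2; move: en; move: (n.+1%:R^-1) => e1.
have : inf V <= enorm w by apply: (inf_lbound infV.2); exists w.
lra.
Qed.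

(* One step of the catching-up scheme; [w] is the increment of the Lipschitz
   perturbation. *)
Lemma implicit_step A A' x a' w (nu rho M : R) : maximal_monotone A ->
  A' x a' -> 0 < nu -> 0 <= rho -> rho <= nu -> 0 <= M -> enorm w <= nu * M ->
  (forall y a, A y a ->
     dotp (a - a') (x - y) <= rho * (1 + enorm a + enorm a')) ->
  exists y a, [/\ A y a, y = x - nu *: a - w & enorm a <= enorm a' + 2 * M + 2].
Proof.
move=> mA xa' nu0 rho0 rhonu M0 wM disA.
have [y [a [ya ywa]]] := minty (x - w) mA nu0.
have yE : y = x - nu *: a - w.
  by rewrite -(addrAC x) -ywa addrK.
exists y, a; split => //.
(* Inserting [x - y = nu a + w] in the hypothesis and dividing by [nu] gives [p^2 - p p' - (p + p')
   M - 1 - p - p' <= 0] for the norms [p], [p'] of [a], [a']; this fails once [p > p' + 2 M + 2]. *)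
rewrite leNgt; apply/negP => agt.
have := disA y a ya; rewrite yE !dotpE.
have := norm_dotp_le a w; rewrite ler_norml => /andP[+ _].
have := norm_dotp_le a' w; rewrite ler_norml => /andP[_ +].
have := dotp_le a' a; rewrite (dotpC a' a) -(sqr_enorm a).
set p := enorm a in agt *; set p' := enorm a' in agt *; set q := enorm w in wM *.
have p0 : 0 <= p := enorm_ge0 a; have p'0 : 0 <= p' := enorm_ge0 a'.
rewrite (dotpC a' x) (dotpC a x) => h1 h2 h3.
have : rho * (1 + p + p') <= nu * (1 + p + p').
  by rewrite ler_wpM2r// !addr_ge0.
have : (p + p') * q <= (p + p') * (nu * M) by rewrite ler_wpM2l// addr_ge0.
have : nu * dotp a a' <= nu * (p * p') by rewrite ler_pM2l// mulrC.
move=> h4 h5 h6 h7.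
have : nu * (p ^+ 2 - p * p' - (p + p') * M - 1 - p - p') <= 0.
  move: h7; lra.
rewrite pmulr_rle0//; nra.
Qed.

End maximal_monotone_theory.

(** * Partitions adapted to a nondecreasing function *)

Section grid.
Context {R : realType}.
Implicit Types (f : R -> R) (t : nat -> R) (e s : R).

(** Nodes may coincide, and all are 1 from [N] on. For nondecreasing [f], a jump larger than [e]
    must sit at a node, where the strict bound [s < t k.+1] ignores it. *)
Definition grid f e N t : Prop :=
  [/\ t 0%N = 0, t N = 1, forall k, t k <= t k.+1, forall k, 0 <= t k <= 1 &
      forall k s, t k <= s < t k.+1 -> f s - f (t k) <= e].

(** The nodes are [t k = sup {s | f s <= k e}]: monotonicity gives [f <= k.+1 e] to the left of
    [t k.+1], and right continuity gives [f (t k) >= k e], since otherwise [t k] could be moved to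
    the right. *)
Lemma grid_exists f e : 0 < e -> f 0 = 0 ->
  {in `[0, 1] &, {homo f : s t / s <= t}} ->
  (forall t : R, t \in `[0, 1[ -> f x @[x --> t^'+] --> f t) ->
  exists N t, grid f e N t.
Proof.
move=> e0 f0 fnd frc.
pose V k := [set s | 0 <= s <= 1 /\ f s <= k%:R * e].
have V0 k : V k 0 by split; rewrite ?lexx ?ler01// f0 mulr_ge0// ltW.
have supV k : has_sup (V k) by split; [exists 0|exists 1 => s [/andP[]]].
(* [f] may vanish on an interval, so the supremum for [k = 0] need not be 0. *)
pose t k := if k is 0%N then 0 else sup (V k).
have t01 k : 0 <= t k <= 1.
  case: k => [|k]; rewrite /t ?lexx ?ler01//.
  rewrite (sup_upper_bound (supV k.+1)) ?V0//=.
  by apply: sup_le_ub => [|s [/andP[]//]]; exists 0.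
have tlt k s : 0 <= s -> s < t k -> f s <= k%:R * e.
  case: k => [|k] s0; rewrite /t; first by rewrite ltNge s0.
  move=> /(sup_gt (supV k.+1).1)[u [/andP[u0 u1] fu] su].
  by apply: le_trans fu; apply: fnd; rewrite ?in_itv/= ?u0 ?s0 ?u1 ?(le_trans (ltW su) u1)// ltW.
have let_ k s : 0 <= s <= 1 -> f s <= k%:R * e -> s <= sup (V k).
  by move=> s01 fs; apply: (sup_upper_bound (supV k)).
have ft k : t k < 1 -> k%:R * e <= f (t k).
  case: k => [|k tk1]; first by rewrite mul0r f0.
  rewrite leNgt; apply/negP => lt.
  have tk0 := t01 k.+1.
  have tin : t k.+1 \in `[0, 1[ by rewrite in_itv/= tk1 andbT; case/andP: tk0.
  have /cvgr_lt/(_ _ lt) := frc _ tin.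
  move=> near_lt.
  have : \forall x \near (t k.+1)^'+, t k.+1 < x /\ x < 1 /\ f x < k.+1%:R * e.
    near=> x; split; last split.
    - by near: x; exact: nbhs_right_gt.
    - by near: x; exact: nbhs_right_lt.
    - by near: x; exact: near_lt.
  move=> /filter_ex[x [tx [x1 fx]]].
  have := let_ k.+1 x; rewrite (ltW fx) (ltW x1) (le_trans _ (ltW tx))//; last by case/andP: tk0.
  by move=> /(_ isT isT); rewrite leNgt tx.
exists (Num.truncn (f 1 / e)).+1, t; split => //.
- apply/eqP; rewrite eq_le; have /andP[_ ->]/= := t01 (Num.truncn (f 1 / e)).+1.
  apply: let_; first by rewrite ler01 lexx.
  by rewrite -ler_pdivrMr// ltW// truncnS_gt.
- case=> [|k]; first by case/andP: (t01 1%N).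
  apply: sup_le_ub => [|s [s01 fs]]; first by exists 0.
  apply: let_ => //; apply: (le_trans fs); rewrite ler_pM2r// ler_nat//.
- move=> k s /andP[tks stk1].
  have s0 : 0 <= s by rewrite (le_trans _ tks)//; case/andP: (t01 k).
  have tk1 : t k < 1.
    by apply: (le_lt_trans tks); apply: (lt_le_trans stk1); case/andP: (t01 k.+1).
  have := ft k tk1; have := tlt k.+1 s s0 stk1.
  rewrite -natr1; lra.
Unshelve. all: by end_near. Qed.

(** Allows the number of a cell to be defined by counting nodes: comparing this number with an index
    amounts to comparing a point with a node. *)
Lemma sum_downset (P : pred nat) N : (forall k, P k.+1 -> P k) ->
  forall k, (k < N)%N -> (k < \sum_(j < N) P j)%N = P k.
Proof.
move=> Pd; have Pdd j k : (j <= k)%N -> P k -> P j.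
  elim: k => [|k IH]; first by rewrite leqn0 => /eqP ->.
  by rewrite leq_eqVlt => /orP[/eqP ->//|jk] /Pd; exact: IH.
elim: N => // N IH k; rewrite ltnS big_ord_recr/= => kN.
have sN : (\sum_(j < N) P j <= N)%N.
  apply: (@leq_trans (\sum_(j < N) 1)); last by rewrite sum1_card card_ord.
  by apply: leq_sum => j _; exact: leq_b1.
case PN : (P N); last first.
  rewrite addn0; move: kN; rewrite leq_eqVlt => /orP[/eqP ->|/IH//].
  by rewrite PN ltnNge sN.
have -> : (\sum_(j < N) P j)%N = N.
  rewrite (eq_bigr (fun=> 1%N)) ?sum1_card ?card_ord// => j _.
  by rewrite (Pdd j N)// ltnW.
by rewrite addn1 ltnS kN (Pdd k N).
Qed.

(* The number of the cell [t k, t k.+1[ (resp. ]t k.-1, t k]) containing s. *)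
Definition cell N t s : nat := (\sum_(k < N) (t k.+1 <= s)%R)%N.
Definition lcell N t s : nat := (\sum_(k < N) (t k < s)%R)%N.

Section cells.
Variables (f : R -> R) (e : R) (N : nat) (t : nat -> R).
Hypothesis gt : grid f e N t.

Lemma grid_le i j : (i <= j)%N -> t i <= t j.
Proof.
case: gt => _ _ td _ _; elim: j => [|j IH]; first by rewrite leqn0 => /eqP ->.
rewrite leq_eqVlt => /orP[/eqP -> //|ij]; exact: le_trans (IH ij) (td j).
Qed.

Lemma ltn_cell s k : (k < N)%N -> (k < cell N t s)%N = (t k.+1 <= s)%R.
Proof.
apply: (@sum_downset (fun k => t k.+1 <= s)) => j.
by apply: le_trans; exact: grid_le.
Qed.

Lemma ltn_lcell s k : (k < N)%N -> (k < lcell N t s)%N = (t k < s).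
Proof.
apply: (@sum_downset (fun k => t k < s)) => j.
by apply: le_lt_trans; exact: grid_le.
Qed.

Lemma cell_le s : (cell N t s <= N)%N.
Proof.
apply: (@leq_trans (\sum_(j < N) 1)); last by rewrite sum1_card card_ord.
by apply: leq_sum => j _; exact: leq_b1.
Qed.

Lemma lcell_le s : (lcell N t s <= N)%N.
Proof.
apply: (@leq_trans (\sum_(j < N) 1)); last by rewrite sum1_card card_ord.
by apply: leq_sum => j _; exact: leq_b1.
Qed.

Lemma cellE s k : (k < N)%N -> t k <= s < t k.+1 -> cell N t s = k.
Proof.
move=> kN /andP[tks stk]; apply/eqP; rewrite eqn_leq; apply/andP; split.
  by rewrite leqNgt ltn_cell// -ltNge.
by case: k kN tks {stk} => // k kN tks; rewrite ltn_cell// ltnW.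
Qed.

Lemma lcellE s k : (k < N)%N -> t k < s <= t k.+1 -> lcell N t s = k.+1.
Proof.
move=> kN /andP[tks stk]; apply/eqP; rewrite eqn_leq; apply/andP; split; last first.
  by rewrite ltn_lcell.
move: kN; rewrite leq_eqVlt => /orP[/eqP ->|kN]; first exact: lcell_le.
by rewrite leqNgt ltn_lcell// -leNgt.
Qed.

Lemma t_cell_le s : 0 <= s -> t (cell N t s) <= s.
Proof.
move=> s0; case E : (cell N t s) => [|k]; first by case: gt => ->.
by have := cell_le s; rewrite E => kN; rewrite -ltn_cell// E.
Qed.

Lemma t_cell_near s : 0 <= s <= 1 -> 0 <= e -> f s - f (t (cell N t s)) <= e.
Proof.
move=> /andP[s0 s1] e0; have := cell_le s; rewrite leq_eqVlt => /orP[/eqP cN|cN].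
  have := t_cell_le s0; rewrite cN; case: gt => _ -> _ _ _ s1'.
  by have -> : s = 1 by [apply/eqP; rewrite eq_le s1]; rewrite subrr.
case: gt => _ _ _ _; apply; rewrite t_cell_le//=.
by rewrite ltNge -ltn_cell// ltnn.
Qed.

Lemma lcellP s : 0 < s <= 1 ->
  exists k, [/\ (k < N)%N, lcell N t s = k.+1, t k < s & s <= t k.+1].
Proof.
move=> /andP[s0 s1]; have [t0 tN _ _ _] := gt.
have N0 : (0 < N)%N.
  by rewrite lt0n; apply/eqP => N0; move: tN t0; rewrite N0 => -> /eqP; rewrite oner_eq0.
have := @ltn_lcell s 0 N0; rewrite t0 s0.
case E : (lcell N t s) => [//|k] _; have := lcell_le s; rewrite E => kN.
exists k; split => //; first by rewrite -ltn_lcell// E.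
move: (kN); rewrite leq_eqVlt => /orP[/eqP ->|kN']; first by rewrite tN.
by rewrite leNgt -ltn_lcell// E ltnn.
Qed.

(** If [f] grows at least as fast as the identity, its oscillation bounds length: in a cell longer
    than [e], the midpoint of [t k + e] and [t k.+1] would violate the grid condition. *)
Lemma grid_mesh k : 0 <= e ->
  (forall s s', 0 <= s -> s <= s' -> s' <= 1 -> s' - s <= f s' - f s) ->
  t k.+1 - t k <= e.
Proof.
move=> e0 fs; have [_ _ td t01 te] := gt.
rewrite lerBlDl leNgt; apply/negP => lt.
have /andP[tk0 _] := t01 k; have /andP[_ tk1] := t01 k.+1.
pose s := (t k + e + t k.+1) / 2.
have := fs (t k) s tk0; have := te k s; rewrite /s => h1 h2.
have := h1 _; have := h2 _ _; lra.
Qed.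

End cells.
End grid.

(** * Integrals of bounded functions *)

Section bounded_integral.
Context {d : measure_display} {T : measurableType d} {R : realType}.
Variables (mu : {measure set T -> \bar R}) (D : set T).
Hypotheses (mD : measurable D) (muD : (mu D < +oo)%E).
Implicit Types (f : T -> R) (K : R).

Lemma bounded_integrable f K : measurable_fun D f ->
  (forall x, D x -> `|f x| <= K) -> mu.-integrable D (EFin \o f).
Proof.
move=> mf fK; apply: measurable_bounded_integrable => //.
exists K; split; first exact: num_real.
by move=> K' KK' x Dx; exact: le_trans (fK x Dx) (ltW KK').
Qed.

Lemma norm_Rintegral_le f K : measurable_fun D f ->
  (forall x, D x -> `|f x| <= K) ->
  `|\int[mu]_(x in D) f x| <= K * fine (mu D).
Proof.
move=> mf fK; rewrite -(Rintegral_cst mu mD).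
apply: (@le_trans _ _ (\int[mu]_(x in D) `|f x|)).
  by apply: le_normr_Rintegral => //; exact: bounded_integrable fK.
apply: le_Rintegral => //.
- apply: (@bounded_integrable _ K); first exact: measurableT_comp.
  by move=> x Dx; rewrite normr_id fK.
- by apply: (@bounded_integrable _ `|K|).
Qed.

Lemma bounded_convergence (f_ : nat -> T -> R) f K :
  (forall n, measurable_fun D (f_ n)) -> measurable_fun D f ->
  (forall n x, D x -> `|f_ n x| <= K) ->
  {ae mu, forall x, D x -> f_ n x @[n --> \oo] --> f x} ->
  mu.-integrable D (EFin \o f) /\
  (\int[mu]_(x in D) f_ n x @[n --> \oo] --> \int[mu]_(x in D) f x).
Proof.
move=> mf_ mf fK ff.
have [|||||intf _ b] := @dominated_convergence _ T R mu D mD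
  (fun n x => (f_ n x)%:E) (EFin \o f) (cst K%:E).
- by move=> n; exact/measurable_EFinP.
- exact/measurable_EFinP.
- by apply: filterS ff => x + Dx => /(_ Dx) fx; apply: cvg_EFin => //; exact: nearW.
- apply: (@bounded_integrable (cst K) `|K|) => //.
- by apply: aeW => x n Dx; rewrite /= lee_fin fK.
by split => //; move: b; rewrite -(fineK (integrable_fin_num mD intf)) => /fine_cvgP[_].
Qed.

End bounded_integral.

Section vector_integral.
Context {R : realType} {d : nat}.
Variable mu : {measure set (measurableTypeR R) -> \bar R}.
Implicit Types (D : set (measurableTypeR R)) (f : R -> 'rV[R]_d) (K : R).

Definition vmeasurable D f :=
  forall i, measurable_fun D (fun s : measurableTypeR R => f s 0 i).

Lemma eq_vintegral D f g : {in D, f =1 g} -> vintegral mu D f = vintegral mu D g.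
Proof.
by move=> fg; apply/rowP => i; rewrite !mxE; apply: eq_Rintegral => x /fg ->.
Qed.

Lemma vintegral_set0 f : vintegral mu set0 f = 0.
Proof. by apply/rowP => i; rewrite !mxE Rintegral_set0. Qed.

Lemma vintegral_cst D (x : 'rV[R]_d) : measurable D ->
  vintegral mu D (fun=> x) = fine (mu D) *: x.
Proof.
by move=> mD; apply/rowP => i; rewrite !mxE Rintegral_cst// mulrC.
Qed.

Lemma vmeasurable_integrable D f K i : measurable D -> (mu D < +oo)%E ->
  vmeasurable D f -> (forall x, D x -> enorm (f x) <= K) ->
  mu.-integrable D (EFin \o (fun s => f s 0 i)).
Proof.
move=> mD muD mf fK; apply: (@bounded_integrable _ _ _ _ _ mD muD _ K) => //.
by move=> x Dx; exact: le_trans (coord_le_enorm _ _) (fK x Dx).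
Qed.

Lemma enorm_vintegral_le D f K : measurable D -> (mu D < +oo)%E ->
  vmeasurable D f -> (forall x, D x -> enorm (f x) <= K) ->
  enorm (vintegral mu D f) <= d%:R * (K * fine (mu D)).
Proof.
move=> mD muD mf fK; apply: enorm_le_coord => i; rewrite mxE.
apply: norm_Rintegral_le => // x Dx.
exact: le_trans (coord_le_enorm _ _) (fK x Dx).
Qed.

Lemma vintegral_setU A B f K : measurable A -> measurable B ->
  (mu (A `|` B) < +oo)%E -> [disjoint A & B] ->
  vmeasurable (A `|` B) f -> (forall x, (A `|` B) x -> enorm (f x) <= K) ->
  vintegral mu (A `|` B) f = vintegral mu A f + vintegral mu B f.
Proof.
move=> mA mB muAB AB mf fK; apply/rowP => i; rewrite !mxE Rintegral_setU//.
by apply: (@vmeasurable_integrable _ _ K) => //; exact: measurableU.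
Qed.

End vector_integral.

(** * Measurability and measures of intervals *)

Lemma dependent_choice_along (T : Type) (P : nat -> T -> Prop)
    (Q : nat -> T -> T -> Prop) x0 :
  P 0%N x0 -> (forall k x, P k x -> exists y, P k.+1 y /\ Q k x y) ->
  exists u, [/\ u 0%N = x0, forall k, P k (u k) & forall k, Q k (u k) (u k.+1)].
Proof.
move=> P0 PQ.
have /choice[F FP] : forall p : nat * T, exists y,
    P p.1 p.2 -> P p.1.+1 y /\ Q p.1 p.2 y.
  move=> [k x]; have [/PQ[y yP]|nP] := pselect (P k x); first by exists y.
  by exists x.
pose u := fix u k := if k is k'.+1 then F (k', u k') else x0.
have uP k : P k (u k) by elim: k => // k /(FP (k, _))[].
by exists u; split => // k; case: (FP (k, u k) (uP k)).
Qed.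

Lemma measurable_coord {R : realType} {d : nat} (i : 'I_d) :
  measurable_fun setT (fun y : borelType 'rV[R]_d => (y : 'rV[R]_d) 0 i : measurableTypeR R).
Proof.
apply: (measurability _ (RGenOpens.measurableE R)).
move=> _ [_ [a [b ->]] <-]; rewrite setTI; apply: sub_sigma_algebra.
have /continuousP := @coord_continuous R 1 d 0 i; apply.
exact: interval_open.
Qed.

Section step_functions.
Context {R : realType}.

Lemma natr_step_sum {V : zmodType} (F : nat -> V) N k : (k <= N)%N ->
  F k = F 0%N + \sum_(j < N) (F j.+1 - F j) *+ (j < k)%N.
Proof.
elim: N k => [|N IH] k; first by rewrite leqn0 => /eqP ->; rewrite big_ord0 addr0.
rewrite leq_eqVlt => /orP[/eqP ->|]; last first.
  by rewrite ltnS => kN; rewrite big_ord_recr/= ltnNge kN addr0 -IH.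
rewrite big_ord_recr/= leqnn mulr1n addrA.
rewrite [X in _ = X + _](_ : _ = F N); first by rewrite addrC subrK.
rewrite [RHS](IH N)//; congr (_ + _).
by apply: eq_bigr => j _; rewrite ltnS ltn_ord ltnW.
Qed.

(** Telescoping writes [F (k s) s] as [F 0 s] plus a finite sum of increments [F j.+1 s - F j s]
    times indicators of [p j]. *)
Lemma measurable_steps (D : set (measurableTypeR R)) (F : nat -> R -> R)
    (p : nat -> pred R) N (k : R -> nat) :
  (forall j, (j <= N)%N -> measurable_fun D (F j)) ->
  (forall j, measurable ([set s | p j s] : set (measurableTypeR R))) ->
  (forall s j, (j < N)%N -> (j < k s)%N = p j s) -> (forall s, (k s <= N)%N) ->
  measurable_fun D (fun s => F (k s) s).
Proof.
move=> mF mp kp kN.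
have -> : (fun s => F (k s) s) = (fun s => F 0%N s +
    \sum_(j < N) (F j.+1 s - F j s) * \1_[set s | p j s] s).
  apply/funext => s; rewrite (natr_step_sum (F ^~ s) (kN s)); congr (_ + _).
  by apply: eq_bigr => j _; rewrite kp// indicE mulr_natr mem_setE.
apply: measurable_funD; first exact: mF.
apply: measurable_sum => j; apply: measurable_funM.
  by apply: measurable_funB; apply: mF => //; exact: ltnW.
exact: measurable_indic.
Qed.

End step_functions.

Section measures.
Context {R : realType}.
Implicit Types (s t a b : R).

Lemma lebesgue_measure_itvco a b : a <= b ->
  lebesgue_measure (`[a, b[%classic : set R) = (b - a)%:E.
Proof.
move=> ab; rewrite lebesgue_measure_itv/= lte_fin; case: ltP => ba; first by rewrite EFinB.
by have -> : a = b by [apply/eqP; rewrite eq_le ab]; rewrite subrr.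
Qed.

Variable (r : R -> R).
Hypothesis rnd : {in `[0, 1] &, {homo r : s t / s <= t}}.
Hypothesis rrc : forall t : R, t \in `[0, 1[ -> r x @[x --> t^'+] --> r t.

Lemma nu_itvoc s t : 0 <= s -> s <= t -> t <= 1 ->
  nu rnd rrc `]s, t]%classic = (t + r t - (s + r s))%:E.
Proof.
move=> s0 st t1; rewrite [LHS](measure_addE (@lambdaI R) (drI rnd rrc)).
have sub : `]s, t]%classic `&` `[0, 1]%classic = `]s, t]%classic :> set R.
  apply: setIidl => x /=; rewrite !in_itv/= => /andP[sx xt].
  by rewrite (le_trans s0 (ltW sx)) (le_trans xt t1).
transitivity (lebesgue_measure (`]s, t]%classic : set R) +
    dr rnd rrc `]s, t]%classic)%E.
  by congr (_ + _)%E; rewrite -[in RHS]sub.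
rewrite dr_itvoc//.
rewrite lebesgue_measure_itv/= lte_fin; case: ltP => ts.
  by rewrite -EFinB -EFinD opprD addrACA.
by have -> : s = t by [apply/eqP; rewrite eq_le st]; rewrite !subrr add0e.
Qed.

Lemma nu_lty X : measurable X -> (nu rnd rrc X < +oo)%E.
Proof. by move=> mX; rewrite ltey_eq fin_num_measure. Qed.

End measures.

Section interval_additivity.
Context {R : realType} {d : nat}.
Variables (mu : {measure set (measurableTypeR R) -> \bar R}) (x : bool).
Variable F : R -> R.
(** The boolean treats both kinds of cells at once: [true] gives [[s, t[], used with Lebesgue
    measure, and [false] gives []s, t]], used with [nu], whose atoms make the choice matter. *)
Local Notation I s t := ([set` Interval (BSide x s) (BSide x t)] : set (measurableTypeR R)).
Hypothesis muI : forall s t, 0 <= s -> s <= t -> t <= 1 -> mu (I s t) = (F t - F s)%:E.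
Variables (f : R -> 'rV[R]_d) (K : R).
Hypothesis mf : vmeasurable `[0, 1]%classic f.
Hypothesis fK : forall s, s \in `[0, 1] -> enorm (f s) <= K.

Let I01 s t : 0 <= s -> t <= 1 -> I s t `<=` `[0, 1]%classic.
Proof. by move=> s0 t1; apply: subset_itv; case: x; rewrite bnd_simp.
Qed.

Let mI s t : 0 <= s -> t <= 1 -> vmeasurable (I s t) f.
Proof.
move=> s0 t1 i; apply: (measurable_funS _ (I01 s0 t1)) => //; exact: mf.
Qed.

Lemma vintegral_additive s t u : 0 <= s -> s <= t -> t <= u -> u <= 1 ->
  vintegral mu (I s u) f = vintegral mu (I s t) f + vintegral mu (I t u) f.
Proof.
move=> s0 st tu u1; have su := le_trans st tu.
have IU : I s u = I s t `|` I t u.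
  by apply: itv_bndbnd_setU; rewrite bnd_simp.
rewrite IU; apply: (@vintegral_setU _ _ _ _ _ _ K) => //.
- by rewrite -IU muI// ltry.
- apply/disj_setPS => y []/=; rewrite !in_itv/=.
  case: x => /= /andP[_ yt] /andP[ty _].
    by move: ty; rewrite leNgt yt.
  by move: ty; rewrite ltNge yt.
- by rewrite -IU; exact: mI.
- by rewrite -IU => y /(I01 s0 u1); exact: fK.
Qed.

Lemma enorm_vintegral_itv_le s t : 0 <= s -> s <= t -> t <= 1 ->
  enorm (vintegral mu (I s t) f) <= d%:R * (K * (F t - F s)).
Proof.
move=> s0 st t1; have := @enorm_vintegral_le R d mu (I s t) f K.
rewrite muI//=; apply => //; first by rewrite ltry.
  exact: mI.
by move=> y /(I01 s0 t1); exact: fK.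
Qed.

Lemma vintegral_cells (t : nat -> R) (G : nat -> 'rV[R]_d) N : t 0%N = 0 ->
  (forall k, t k <= t k.+1) -> (forall k, t k <= 1) ->
  (forall k, (k < N)%N -> vintegral mu (I (t k) (t k.+1)) f = G k.+1 - G k) ->
  forall k, (k <= N)%N -> vintegral mu (I 0 (t k)) f = G k - G 0%N.
Proof.
move=> t0 td t1 tG; elim=> [|k IH] kN.
  by rewrite t0 subrr set_itvxx vintegral_set0.
have tk0 j : 0 <= t j by elim: j => [|j]; [rewrite t0|move=> /le_trans; apply].
rewrite (@vintegral_additive 0 (t k))//.
by rewrite (IH (ltnW kN)) tG// addrC addrA subrK.
Qed.

(** The sums are exact at the nodes, so the error at [u] is the integral over the piece between
    [t k] and [u]. *)
Lemma vintegral_cells_near (t : nat -> R) (G : nat -> 'rV[R]_d) N k u : t 0%N = 0 ->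
  (forall k, t k <= t k.+1) -> (forall k, t k <= 1) ->
  (forall k, (k < N)%N -> vintegral mu (I (t k) (t k.+1)) f = G k.+1 - G k) ->
  (k <= N)%N -> t k <= u -> u <= 1 ->
  enorm (G k - G 0%N - vintegral mu (I 0 u) f) <= d%:R * (K * (F u - F (t k))).
Proof.
move=> t0 td t1 tG kN tku u1.
have tk0 j : 0 <= t j by elim: j => [|j]; [rewrite t0|move=> /le_trans; apply].
rewrite (@vintegral_additive 0 (t k))// (vintegral_cells t0 td t1 tG kN).
by rewrite opprD addrA subrr sub0r enormN enorm_vintegral_itv_le.
Qed.

End interval_additivity.

(** * Approximate solutions *)

(* The distribution function of nu. *)
Definition clock {R : realType} (r : R -> R) (t : R) : R := t + r t.

Section approximate_solutions.
Context {R : realType} {d : nat}.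
Local Notation E := 'rV[R]_d.
Variables (A : R -> E -> set E) (r : R -> R) (c M : R) (b : R -> E -> E) (y0 : E).
Hypothesis A_maxmon : forall t, t \in `[0, 1] -> maximal_monotone (A t).
Hypothesis r_rc : forall t : R, t \in `[0, 1[ -> r x @[x --> t^'+] --> r t.
Hypothesis r_nd : {in `[0, 1] &, {homo r : s t / s <= t}}.
Hypothesis r0 : r 0 = 0.
Hypothesis dis_le : forall s t, 0 <= s -> s <= t -> t <= 1 ->
      (dis (A t) (A s) <= (r t - r s)%:E)%E.
Hypothesis c_ge0 : 0 <= c.
Hypothesis A0_le : forall t x, t \in `[0, 1] -> dom (A t) x ->
      enorm (min_section (A t) x) <= c * (1 + enorm x).
Hypothesis b_meas : @measurable_fun _ _
      (measurableTypeR R * borelType 'rV[R]_d)%type (borelType 'rV[R]_d)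
      (`[0, 1]%classic `*` setT) (fun p => b p.1 p.2).
Hypothesis M_ge0 : 0 <= M.
Hypothesis b_bnd : forall t x, t \in `[0, 1] -> enorm (b t x) <= M.
Hypothesis y0_dom : dom (A 0) y0.

Local Notation lambda := (@lebesgue_measure R).
Local Notation nu := (nu r_nd r_rc).
Local Notation phi := (clock r).

Lemma phi_increase s t : 0 <= s -> s <= t -> t <= 1 -> t - s <= phi t - phi s.
Proof.
move=> s0 st t1; have : r s <= r t.
  by apply: r_nd => //; rewrite in_itv/= ?s0 ?t1 ?(le_trans s0)// (le_trans st).
by rewrite /clock; lra.
Qed.

Lemma phi0 : phi 0 = 0. Proof. by rewrite /clock r0 addr0. Qed.

Lemma phi_nd s t : 0 <= s -> s <= t -> t <= 1 -> phi s <= phi t.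
Proof. by move=> s0 st t1; have := phi_increase s0 st t1; lra. Qed.

Lemma phi_rc (t : R) : t \in `[0, 1[ -> phi x @[x --> t^'+] --> phi t.
Proof.
move=> t01; apply: cvgD; last exact: r_rc.
exact/cvg_at_right_filter/cvg_id.
Qed.

Lemma dis_graph s t x y x' y' : 0 <= s -> s <= t -> t <= 1 ->
  A t x y -> A s x' y' ->
  dotp (y - y') (x' - x) <= (r t - r s) * (1 + enorm y + enorm y').
Proof.
move=> s0 st t1 xy xy'.
have p0 : 0 < 1 + enorm y + enorm y'.
  by rewrite -addrA ltr_pwDl// addr_ge0 ?enorm_ge0.
rewrite -ler_pdivrMr// -lee_fin (le_trans _ (dis_le s0 st t1))//.
apply: ereal_sup_ubound; exists x, y, x', y'; split => //; [by exists y|by exists y'].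
Qed.

Lemma measurable_section (u : E) : vmeasurable `[0, 1]%classic (fun s => b s u).
Proof.
move=> i; apply: (measurableT_comp (measurable_coord i)).
apply: (@measurable_comp _ _ _ (measurableTypeR R)
  (measurableTypeR R * borelType E)%type (borelType E) _
  (fun p => b p.1 p.2) _ (fun s => (s, u)) _ _ b_meas).
- by apply: measurableX => //; exact: measurable_itv.
- by move=> _ [s s01 <-].
- apply: measurable_funTS; apply: measurable_fun_pair => //; exact: measurable_id.
Qed.

(** [M1] bounds integrals of [b]; its factor [d] comes from estimating vector integrals by
    coordinates. [G] is a discrete Gronwall bound, with [1 + r 1 = phi 1]. In [rate], [c + 2 M1 + 2]
    is due to the velocity and one more [M1] to the drift. [K] is the resulting bound on the
    velocities. *)
Let M1 := d%:R * M.
Let M1_ge0 : 0 <= M1. Proof. by rewrite mulr_ge0. Qed.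
Let rate := c + 3 * M1 + 2.
Let G := (1 + enorm y0) * expR (rate * (1 + r 1)).
Let K := c * G + 2 * M1 + 2.

(** The minimal section at [y] is the reference velocity [a'] of [implicit_step], bounded by the
    linear growth hypothesis. *)
Lemma grid_step s t y w : 0 <= s -> s <= t -> t <= 1 -> dom (A s) y ->
  enorm w <= (t - s) * M1 ->
  exists y' a, [/\ A t y' a, y' = y - (phi t - phi s) *: a - w &
    enorm a <= c * (1 + enorm y) + 2 * M1 + 2].
Proof.
move=> s0 st t1 ys wM.
have s01 : s \in `[0, 1] by rewrite in_itv/= s0 (le_trans st).
have t01 : t \in `[0, 1] by rewrite in_itv/= t1 (le_trans s0).
have a0 := min_section_mem (A_maxmon s01) ys.
have a0c := A0_le s01 ys.
(* Coinciding nodes give a step of zero weight: [y] is kept, with its minimal section as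
   velocity. *)
have [ts|ts] := leP t s.
  have {}ts : s = t by apply/eqP; rewrite eq_le st.
  exists y, (min_section (A s) y); split; first by rewrite -ts.
    have -> : w = 0 by apply: enorm_eq0; rewrite (le_trans wM)// ts subrr mul0r.
    by rewrite ts subrr scale0r !subr0.
  by rewrite -addrA ler_wpDr// addr_ge0// mulr_ge0.
have inc := phi_increase s0 st t1.
have nu0 : 0 < phi t - phi s by lra.
have [|||||y' [a [Aa yE aC]]] := @implicit_step R d (A t) (A s) y _ w _
    (r t - r s) M1 (A_maxmon t01) a0 nu0.
- by rewrite subr_ge0; apply: r_nd.
- by rewrite /clock; lra.
- exact: M1_ge0.
- by rewrite (le_trans wM)// ler_wpM2r.
- by move=> y' a Aa; exact: (dis_graph s0 st t1 Aa a0).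
by exists y', a; split => //; rewrite (le_trans aC)// !lerD2r.
Qed.

(** Discrete Gronwall: a step multiplies the bound on [1 + |Y|] by at most
    [1 + rate q <= expR (rate q)], where [q] is the increment of [phi]. The bound on [B] rests on
    that of [b] alone, so it is available before [Y] is estimated. *)
Lemma scheme_exists (t : nat -> R) : t 0%N = 0 -> (forall k, t k <= t k.+1) ->
  (forall k, 0 <= t k <= 1) ->
  exists (Y B a : nat -> E), [/\ Y 0%N = y0 /\ B 0%N = 0,
    forall k, A (t k) (Y k) (a k),
    forall k, [/\ enorm (B k) <= M1, enorm (Y k) <= G & enorm (a k) <= K],
    forall k, Y k.+1 = Y k - (phi (t k.+1) - phi (t k)) *: a k.+1
                       - (t k.+1 - t k) *: B k &
    forall k, B k.+1 = B k +
      vintegral lambda `[t k, t k.+1[%classic (fun s => b s (B k + Y k))].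
Proof.
move=> t0 td t01.
have t0k k : 0 <= t k by case/andP: (t01 k).
have tk1 k : t k <= 1 by case/andP: (t01 k).
have rate0 : 0 <= rate by rewrite !addr_ge0// mulr_ge0.
pose g k := (1 + enorm y0) * expR (rate * phi (t k)).
have gG k : g k <= G.
  rewrite ler_wpM2l ?addr_ge0 ?enorm_ge0// ler_expR ler_wpM2l//.
  exact: phi_nd.
pose Inv k (p : E * E * E) := [/\ A (t k) p.1.1 p.2, enorm p.1.2 <= M1 * t k,
  1 + enorm p.1.1 <= g k & enorm p.2 <= K].
pose Next k (p q : E * E * E) :=
  q.1.1 = p.1.1 - (phi (t k.+1) - phi (t k)) *: q.2 - (t k.+1 - t k) *: p.1.2 /\
  q.1.2 = p.1.2 +
    vintegral lambda `[t k, t k.+1[%classic (fun s => b s (p.1.2 + p.1.1)).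
have [||u [u0 uI uN]] := @dependent_choice_along _ Inv Next
    (y0, 0, min_section (A 0) y0).
- have z01 : 0 \in `[(0:R), 1] by rewrite in_itv/= lexx ler01.
  have g0 : 1 + enorm y0 <= g 0%N.
    by rewrite /g t0 phi0 mulr0 expR0 mulr1.
  split => //=; first by rewrite t0; exact: min_section_mem (A_maxmon z01) _.
    by rewrite enorm0 t0 mulr0.
  rewrite (le_trans (A0_le z01 y0_dom))// /K -addrA ler_wpDr//.
    by rewrite addr_ge0// mulr_ge0.
  by rewrite ler_wpM2l// (le_trans g0).
- move=> k [[Y B] a] [/= Aa BM Yg aK].
  have tkk := td k.
  have inc := phi_increase (t0k k) tkk (tk1 k.+1).
  have BM1 : enorm B <= M1 by rewrite (le_trans BM)// ler_piMr.
  have wM : enorm ((t k.+1 - t k) *: B) <= (t k.+1 - t k) * M1.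
    by rewrite enormZ ger0_norm ?subr_ge0// ler_wpM2l ?subr_ge0.
  have Ydom : dom (A (t k)) Y by exists a.
  have [Y' [a' [Aa' Y'E a'C]]] := grid_step (t0k k) tkk (tk1 k.+1) Ydom wM.
  pose B' := B + vintegral lambda `[t k, t k.+1[%classic (fun s => b s (B + Y)).
  exists (Y', B', a'); split; last by split.
  split => /=; [by []| | |].
  + rewrite (le_trans (ler_enormD _ _))//.
    apply: (@le_trans _ _ (M1 * t k + d%:R * (M * (t k.+1 - t k)))); last first.
      by rewrite /M1; lra.
    rewrite lerD//; apply: (@enorm_vintegral_itv_le _ _ _ true id) => //.
    * by move=> x y _ xy _; exact: lebesgue_measure_itvco.
    * exact: measurable_section.
    * by move=> s s01; exact: b_bnd.
  + have nuB : enorm ((phi (t k.+1) - phi (t k)) *: a') <=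
        (phi (t k.+1) - phi (t k)) * (c * (1 + enorm Y) + 2 * M1 + 2).
      by rewrite enormZ ger0_norm ?ler_wpM2l//; lra.
    have Y'le : enorm Y' <= enorm Y + (phi (t k.+1) - phi (t k)) *
        (c * (1 + enorm Y) + 2 * M1 + 2) + (t k.+1 - t k) * M1.
      rewrite Y'E (le_trans (ler_enormB _ _))// lerD//.
      by rewrite (le_trans (ler_enormB _ _))// lerD2l.
    apply: (@le_trans _ _ ((1 + enorm Y) * expR (rate * (phi (t k.+1) - phi (t k))))); last first.
      rewrite (le_trans (ler_wpM2r (expR_ge0 _) Yg))// /g -mulrA -expRD.
      by rewrite -mulrDr [X in expR (_ * X)]addrC subrK.
    have := ler_wpM2l (addr_ge0 ler01 (enorm_ge0 Y))
      (expR_ge1Dx (rate * (phi (t k.+1) - phi (t k)))).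
    apply: le_trans; move: Y'le; rewrite /rate.
    have : (t k.+1 - t k) * M1 <= (phi (t k.+1) - phi (t k)) * M1.
      by rewrite ler_wpM2r.
    have q0 : 0 <= phi (t k.+1) - phi (t k) by lra.
    have := enorm_ge0 Y; move: q0.
    set p := enorm Y; set q := phi (t k.+1) - phi (t k).
    move=> q0 p0 lM Y'le.
    have : 0 <= q * (1 + p) * M1 by rewrite !mulr_ge0// addr_ge0.
    have : 0 <= q * p * M1 by rewrite !mulr_ge0.
    have : 0 <= q * M1 by rewrite mulr_ge0.
    have : 0 <= q * p by rewrite mulr_ge0.
    lra.
  + rewrite (le_trans a'C)// /K !lerD2r ler_wpM2l//.
    exact: le_trans Yg (gG k).
exists (fun k => (u k).1.1), (fun k => (u k).1.2), (fun k => (u k).2).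
split.
- by rewrite u0.
- by move=> k; case: (uI k).
- move=> k; have [_ uM ug uK] := uI k; split => //.
    by rewrite (le_trans uM)// ler_piMr.
  have := gG k; lra.
- by move=> k; case: (uN k).
- by move=> k; case: (uN k).
Qed.

(** A single constant is chosen before the grid; compactness rests on this uniformity. *)
Lemma bounded_scheme_exists : exists C, 0 <= C /\
  forall t : nat -> R, t 0%N = 0 -> (forall k, t k <= t k.+1) ->
  (forall k, 0 <= t k <= 1) ->
  exists (Y B a : nat -> E), [/\ Y 0%N = y0 /\ B 0%N = 0,
    forall k, A (t k) (Y k) (a k),
    forall k, [/\ enorm (B k) <= C, enorm (Y k) <= C & enorm (a k) <= C],
    forall k, Y k.+1 = Y k - (phi (t k.+1) - phi (t k)) *: a k.+1
                       - (t k.+1 - t k) *: B k &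
    forall k, B k.+1 = B k +
      vintegral lambda `[t k, t k.+1[%classic (fun s => b s (B k + Y k))].
Proof.
have G0 : 0 <= G by rewrite mulr_ge0 ?expR_ge0// addr_ge0 ?enorm_ge0.
have K0 : 0 <= K by rewrite !addr_ge0// mulr_ge0.
have le3 (x y z : R) : 0 <= x -> 0 <= y -> 0 <= z ->
   [/\ 0 <= x + y + z, x <= x + y + z, y <= x + y + z & z <= x + y + z].
  by split; lra.
have [S0 SM SG SK] := le3 _ _ _ M1_ge0 G0 K0.
exists (M1 + G + K); split => // t t0 td t01.
have [Y [B [a [YB Aa bd YE BE]]]] := scheme_exists t0 td t01.
exists Y, B, a; split => // k; have [bB bY ba] := bd k; split.
- exact: le_trans bB SM.
- exact: le_trans bY SG.
- exact: le_trans ba SK.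
Qed.

(* Bb, Yb and Qb are constant on the cells [t k, t k.+1[, with the value of the
   scheme at t k (Qb is Yb plus the drift); Yt and ab are constant on the cells
   ]t k, t k.+1], with the value at t k.+1 = th. *)
Record approx_solution (eps C : R) (Bb Yb Qb Yt ab : R -> E) (th : R -> R) : Prop := {
  ap_Bmeas : vmeasurable `[0, 1]%classic Bb;
  ap_ameas : vmeasurable setT ab;
  ap_bmeas : vmeasurable `[0, 1]%classic (fun s => b s (Bb s + Yb s));
  ap_graph : forall s, s \in `[0, 1] ->
    [/\ A (th s) (Yt s) (ab s), s <= th s, th s <= s + eps & th s <= 1];
  ap_a : forall s, enorm (ab s) <= C;
  ap_B : forall s, enorm (Bb s) <= C;
  ap_Q : forall s, enorm (Qb s) <= C;
  ap_Beq : forall t, t \in `[0, 1] ->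
    enorm (Bb t - vintegral lambda `[0, t[%classic (fun s => b s (Bb s + Yb s)))
    <= C * eps;
  ap_Deq : forall t, t \in `[0, 1] ->
    enorm (Qb t - Yb t - vintegral lambda `[0, t[%classic Bb) <= C * eps;
  ap_Qeq : forall t, t \in `[0, 1] ->
    enorm (y0 - Qb t - vintegral nu `]0, t]%classic ab) <= C * eps;
  ap_Y : forall s, s \in `[0, 1] ->
    enorm (Yt s - Yb s) <= C * (phi (th s) - phi s + eps) }.

Lemma approx_solution_exists : exists C, 0 <= C /\ forall eps, 0 < eps ->
  exists Bb Yb Qb Yt ab th, approx_solution eps C Bb Yb Qb Yt ab th.
Proof.
have [C [C0 sch]] := bounded_scheme_exists.
have d0 : 0 <= d%:R :> R by [].
(* [2 C] bounds [Q] and the increments of [Y] relative to [phi]; the other two terms are the errors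
   of [vintegral_cells_near] for integrands bounded by [C] and by [M]. *)
exists (2 * C + d%:R * C + d%:R * M); split; first by rewrite !addr_ge0 ?mulr_ge0.
move=> eps eps0.
have phind : {in `[0, 1] &, {homo phi : s t / s <= t}}.
  move=> s t; rewrite !in_itv/= => /andP[s0 _] /andP[_ t1] st; exact: phi_nd.
have [N [t gt]] := grid_exists eps0 phi0 phind phi_rc.
have [t0 tN td t01 te] := gt.
have [Y [B [a [[Y0 B0] Aa bd YE BE]]]] := sch t t0 td t01.
have t0k k : 0 <= t k by case/andP: (t01 k).
have tk1 k : t k <= 1 by case/andP: (t01 k).
have near s : s \in `[0, 1] -> [/\ 0 <= s, s <= 1, t (cell N t s) <= s,
    s - t (cell N t s) <= eps & phi s - phi (t (cell N t s)) <= eps].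
  rewrite in_itv/= => /andP[s0 s1]; have tcs := t_cell_le gt s0.
  have cn := t_cell_near gt (introT andP (conj s0 s1)) (ltW eps0).
  split => //; exact: le_trans (phi_increase (t0k _) tcs s1) cn.
pose D k := \sum_(j < k) (t j.+1 - t j) *: B j.
have D0 : D 0%N = 0 by rewrite /D big_ord0.
have DS k : D k.+1 = D k + (t k.+1 - t k) *: B k by rewrite /D big_ord_recr.
have DC k : enorm (D k) <= C.
  suff : enorm (D k) <= C * t k by move=> /le_trans; apply; rewrite ler_piMr.
  elim: k => [|k IH]; first by rewrite D0 enorm0 t0 mulr0.
  rewrite DS (le_trans (ler_enormD _ _))// enormZ ger0_norm ?subr_ge0//.
  have [bB _ _] := bd k.
  have : (t k.+1 - t k) * enorm (B k) <= (t k.+1 - t k) * C.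
    by rewrite ler_wpM2l// subr_ge0.
  lra.
(* Adding [D] cancels the drift term of the scheme: [Q k.+1 - Q k] is minus the increment of [phi]
   times [a k.+1]. *)
pose Q k := Y k + D k.
have Yinc i j : (i <= j)%N -> enorm (Y j - Y i) <= 2 * C * (phi (t j) - phi (t i)).
  elim: j => [|j IH]; first by rewrite leqn0 => /eqP ->; rewrite !subrr enorm0 mulr0.
  rewrite leq_eqVlt => /orP[/eqP -> //|ij]; first by rewrite !subrr enorm0 mulr0.
  have {}IH := IH ij; have inc := phi_increase (t0k j) (td j) (tk1 j.+1).
  have tdj : 0 <= t j.+1 - t j by rewrite subr_ge0.
  have -> : Y j.+1 - Y i = (Y j - Y i) - (phi (t j.+1) - phi (t j)) *: a j.+1
      - (t j.+1 - t j) *: B j.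
    by rewrite YE -!addrA; congr (_ + _); rewrite [in RHS]addrC -!addrA.
  have [bB _ _] := bd j; have [_ _ ba] := bd j.+1.
  apply: (le_trans (ler_enormB _ _)); rewrite enormZ ger0_norm//.
  apply: (@le_trans _ _ (enorm (Y j - Y i) + (phi (t j.+1) - phi (t j)) * C +
      (t j.+1 - t j) * C)).
    apply: lerD; last exact: ler_wpM2l.
    apply: (le_trans (ler_enormB _ _)); rewrite enormZ ger0_norm//; last by lra.
    by rewrite lerD2l ler_wpM2l//; lra.
  have : (t j.+1 - t j) * C <= (phi (t j.+1) - phi (t j)) * C by rewrite ler_wpM2r.
  lra.
have mcell (F : nat -> R -> E) (V : set (measurableTypeR R)) :
    (forall k, vmeasurable V (F k)) -> vmeasurable V (fun s => F (cell N t s) s).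
  move=> mF i; apply: (@measurable_steps _ V (fun k s => F k s 0 i)
    (fun k s => t k.+1 <= s) N (cell N t)).
  - by move=> j _; exact: mF.
  - by move=> j; have := @measurable_itv R `[t j.+1, +oo[; rewrite set_itvcy.
  - by move=> s j; exact: ltn_cell gt _ _.
  - exact: cell_le.
have mlcell (F : nat -> E) : vmeasurable setT (fun s => F (lcell N t s)).
  move=> i; apply: (@measurable_steps _ setT (fun k s => F k 0 i)
    (fun k s => t k < s) N (lcell N t)).
  - by move=> j _; exact: measurable_cst.
  - by move=> j; have := @measurable_itv R `]t j, +oo[; rewrite set_itvoy.
  - by move=> s j; exact: ltn_lcell gt _ _.
  - exact: lcell_le.
have leC3 x y : 0 <= x -> 0 <= y ->
   [/\ C <= 2 * C + x + y, x <= 2 * C + x + y & y <= 2 * C + x + y].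
  by split; lra.
have dC0 : 0 <= d%:R * C by rewrite mulr_ge0.
have dM0 : 0 <= d%:R * M by rewrite mulr_ge0.
have [leC ledC ledM] := leC3 _ _ dC0 dM0.
have remainder x (F : R) y : 0 <= x -> F <= eps -> y <= d%:R * (x * F) ->
    d%:R * x <= 2 * C + d%:R * C + d%:R * M ->
    y <= (2 * C + d%:R * C + d%:R * M) * eps.
  move=> x0 Feps /le_trans + dx; apply; rewrite mulrA.
  apply: (@le_trans _ _ (d%:R * x * eps)); first by rewrite ler_wpM2l// mulr_ge0.
  by rewrite ler_wpM2r// ltW.
have mB : vmeasurable `[0, 1]%classic (fun s => B (cell N t s)).
  by apply: (mcell (fun k _ => B k)) => k i; exact: measurable_cst.
have mb : vmeasurable `[0, 1]%classic
    (fun s => b s (B (cell N t s) + Y (cell N t s))).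
  by apply: (mcell (fun k s => b s (B k + Y k))) => k; exact: measurable_section.
have cellco k s : (k < N)%N -> s \in `[t k, t k.+1[%classic -> cell N t s = k.
  by move=> kN; rewrite inE/= in_itv/= => sk; exact: (cellE gt kN sk).
have lnear s : s \in `[0, 1] -> s <= t (lcell N t s) /\ t (lcell N t s) <= s + eps.
  rewrite in_itv/= => /andP[s0 s1]; have [s00|s00] := leP s 0.
    have -> : lcell N t s = 0%N.
      by rewrite /lcell big1// => k _; rewrite ltNge (le_trans s00).
    by rewrite t0; split => //; rewrite addr_ge0// ltW.
  have s01 : 0 < s <= 1 by rewrite s00.
  have [k [_ -> tks stk]] := lcellP gt s01; split => //.
  have := grid_mesh gt k (ltW eps0) phi_increase; lra.
exists (fun s => B (cell N t s)), (fun s => Y (cell N t s)),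
  (fun s => Q (cell N t s)), (fun s => Y (lcell N t s)),
  (fun s => a (lcell N t s)), (fun s => t (lcell N t s)); split.
- exact: mB.
- exact: mlcell.
- exact: mb.
- move=> s s01; have [le_s s_le] := lnear s s01.
  by split; [exact: Aa| | |exact: tk1].
- by move=> s; have [_ _ h] := bd (lcell N t s); exact: le_trans h leC.
- by move=> s; have [h _ _] := bd (cell N t s); exact: le_trans h leC.
- move=> s; apply: (le_trans (ler_enormD _ _)).
  by have [_ h _] := bd (cell N t s); have := DC (cell N t s); lra.
- move=> s s01; have [s0 s1 tcs tcn _] := near s s01.
  have := @vintegral_cells_near _ _ lambda true id _ _ M mb _ t B N (cell N t s)
    s t0 td tk1 _ (cell_le _ _ _) tcs s1.
  rewrite B0 subr0 => H; apply: (remainder _ _ _ M_ge0 tcn (H _ _ _) ledM).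
  + by move=> x y _ xy _; exact: lebesgue_measure_itvco.
  + by move=> x x01; exact: b_bnd.
  + move=> k kN; rewrite BE [RHS]addrC addKr.
    by apply: eq_vintegral => x xk; rewrite (cellco k).
- move=> s s01; have [s0 s1 tcs tcn _] := near s s01.
  have := @vintegral_cells_near _ _ lambda true id _ _ C mB _ t D N (cell N t s)
    s t0 td tk1 _ (cell_le _ _ _) tcs s1.
  rewrite D0 subr0 /Q [Y _ + _]addrC addrK => H.
  apply: (remainder _ _ _ C0 tcn (H _ _ _) ledC).
  + by move=> x y _ xy _; exact: lebesgue_measure_itvco.
  + by move=> x x01; case: (bd (cell N t x)).
  + move=> k kN; rewrite DS [RHS]addrC addKr.
    rewrite (_ : t k.+1 - t k = fine (lambda `[t k, t k.+1[%classic)).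
      rewrite -vintegral_cst; last exact: measurable_itv.
      by apply: eq_vintegral => x xk; rewrite (cellco k).
    by rewrite lebesgue_measure_itvco.
- move=> s s01; have [s0 s1 tcs _ tcn] := near s s01.
  have ma : vmeasurable `[0, 1]%classic (fun s => a (lcell N t s)).
    by move=> i; apply: measurable_funTS; exact: mlcell.
  have := @vintegral_cells_near _ _ nu false phi _ _ C ma _ t (fun k => - Q k) N
    (cell N t s) s t0 td tk1 _ (cell_le _ _ _) tcs s1.
  rewrite /Q Y0 D0 addr0 opprK [- _ + y0]addrC => H.
  apply: (remainder _ _ _ C0 tcn (H _ _ _) ledC).
  + by move=> x y x0 xy y1; exact: nu_itvoc.
  + by move=> x x01; case: (bd (lcell N t x)).
  + move=> k kN; rewrite opprK -/(Q k) -/(Q k.+1).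
    have -> : - (Y k.+1 + D k.+1) + (Y k + D k) =
        (phi (t k.+1) - phi (t k)) *: a k.+1.
      by rewrite YE DS; apply/rowP => i; rewrite !mxE; ring.
    rewrite (_ : phi (t k.+1) - phi (t k) = fine (nu `]t k, t k.+1]%classic)).
      rewrite -vintegral_cst; last exact: measurable_itv.
      apply: eq_vintegral => x; rewrite inE/= in_itv/= => xk.
      by rewrite (lcellE gt kN).
    by rewrite nu_itvoc.
- move=> s s01; have [s0 s1 tcs _ tcn] := near s s01.
  have le2 : 2 * C <= 2 * C + d%:R * C + d%:R * M by lra.
  set u := t (lcell N t s).
  have [su _] := lnear s s01.
  have phisu := phi_nd s0 su (tk1 _).
  have h0 : 0 <= phi u - phi s + eps by lra.
  apply: (@le_trans _ _ (2 * C * (phi u - phi s + eps))); last by rewrite ler_wpM2r.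
  (* [lcell] falls below [cell] only if several nodes coincide at [s]; then [phi] takes the same
     value at both nodes. *)
  have [ij|ji] := leqP (cell N t s) (lcell N t s).
    apply: (le_trans (Yinc _ _ ij)); rewrite ler_wpM2l ?mulr_ge0//.
    by rewrite -/u; lra.
  rewrite enormBC; apply: (le_trans (Yinc _ _ (ltnW ji))).
  rewrite ler_wpM2l ?mulr_ge0// -/u.
  have := phi_nd s0 su (tk1 _).
  have := phi_nd (t0k _) tcs s1; lra.
Qed.

End approximate_solutions.

(** * Mazur's lemma *)

Section mazur.
Context {R : realType} {d : nat}.
Variable mu : {measure set (measurableTypeR R) -> \bar R}.
Hypothesis muT : (mu setT < +oo)%E.
Variables (g : nat -> R -> 'rV[R]_d) (C : R).
Hypothesis mg : forall n, vmeasurable setT (g n).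
Hypothesis gC : forall n x, enorm (g n x) <= C.

(** Dyadic convex combinations of a tail of the sequence. Midpoints are what the parallelogram
    identity uses, and induction on the hull transports every affine inequality from the
    generators. *)
Inductive midpoint_hull (k : nat) : (R -> 'rV[R]_d) -> Prop :=
| midpoint_hull_gen n : (k <= n)%N -> midpoint_hull k (g n)
| midpoint_hull_mid f h : midpoint_hull k f -> midpoint_hull k h ->
    midpoint_hull k (fun x => 2^-1 *: (f x + h x)).

Lemma midpoint_hullW j k f : (j <= k)%N -> midpoint_hull k f -> midpoint_hull j f.
Proof.
move=> jk; elim=> [n kn|f1 f2 _ IH1 _ IH2]; last exact: midpoint_hull_mid.
by apply: midpoint_hull_gen; exact: leq_trans kn.
Qed.

Lemma midpoint_hull_bounded k f : midpoint_hull k f ->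
  vmeasurable setT f /\ forall x, enorm (f x) <= C.
Proof.
elim=> [n _|f1 f2 _ [mf1 f1C] _ [mf2 f2C]]; first by split.
split=> [i|x].
  rewrite (_ : (fun s => _) = (fun s => 2^-1 * (f1 s 0 i + f2 s 0 i))).
    by apply: measurable_funM => //; apply: measurable_funD; [exact: mf1|exact: mf2].
  by apply/funext => s; rewrite !mxE.
rewrite enormZ ger0_norm ?invr_ge0//.
by have := ler_enormD (f1 x) (f2 x); have := f1C x; have := f2C x; lra.
Qed.

Lemma measurable_dotp (f : R -> 'rV[R]_d) : vmeasurable setT f ->
  measurable_fun setT (fun x : measurableTypeR R => dotp (f x) (f x)).
Proof.
move=> mf; apply: measurable_sum => i; apply: measurable_funM; exact: mf.
Qed.

Let q (f : R -> 'rV[R]_d) := \int[mu]_x dotp (f x) (f x).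

Let int_dotp (f : R -> 'rV[R]_d) (B : R) : vmeasurable setT f -> (forall x, enorm (f x) <= B) ->
  mu.-integrable setT (EFin \o (fun x => dotp (f x) (f x))).
Proof.
move=> mf fB; apply: (@bounded_integrable _ _ _ _ _ _ _ _ (B ^+ 2)) => //.
  exact: measurable_dotp.
move=> x _; rewrite ger0_norm ?dotp_ge0// -sqr_enorm.
by have := enorm_ge0 (f x); have := fB x; nra.
Qed.

(** The parallelogram identity, [q] being the squared norm of [L^2(mu)]. *)
Let q_sub k f h : midpoint_hull k f -> midpoint_hull k h ->
  q (fun x => f x - h x) =
  2 * q f + 2 * q h - 4 * q (fun x => 2^-1 *: (f x + h x)).
Proof.
move=> kf kh.
have [mf fC] := midpoint_hull_bounded kf; have [mh hC] := midpoint_hull_bounded kh.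
have [mm mC] := midpoint_hull_bounded (midpoint_hull_mid kf kh).
have If := int_dotp mf fC; have Ih := int_dotp mh hC; have Im := int_dotp mm mC.
have int_scale (a : R) u : mu.-integrable setT (EFin \o u) ->
    mu.-integrable setT (EFin \o (fun x => a * u x)).
  move=> iu; rewrite (_ : _ \o _ = fun x => (a%:E * (EFin \o u) x)%E)//.
  exact: integrableZl.
rewrite /q -!RintegralZl// -RintegralD//; [|exact: int_scale..].
rewrite -RintegralB//; last 2 first.
- rewrite (_ : _ \o _ = ((EFin \o (fun x => (2 * dotp (f x) (f x))%R)) \+
    (EFin \o (fun x => (2 * dotp (h x) (h x))%R)))%E)//.
  by apply: integrableD => //; exact: int_scale.
- exact: int_scale.
apply: eq_Rintegral => x _; rewrite !dotpE (dotpC (h x)); lra.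
Qed.

Let delta m : R := ((2 ^ m.+1)%:R)^-1.

Let delta_gt0 m : 0 < delta m. Proof. by rewrite invr_gt0 ltr0n expn_gt0. Qed.

Let deltaS m : delta m = 2 * delta m.+1.
Proof.
rewrite /delta [in RHS]expnS natrM invfM mulrA mulfV ?mul1r// pnatr_eq0//.
Qed.

Lemma fast_cauchy_cvg (u : nat -> R) N :
  (forall m, (N <= m)%N -> `|u m.+1 - u m| <= delta m) -> cvgn u.
Proof.
move=> uN.
(* The right-hand side is the exact value of the geometric sum of [delta] from [p] to
   [p + k - 1]. *)
have cau p k : (N <= p)%N -> `|u (p + k)%N - u p| <= 2 * delta p - 2 * delta (p + k)%N.
  move=> Np; elim: k => [|k IH]; first by rewrite addn0 !subrr normr0.
  rewrite addnS; have := uN (p + k)%N (leq_trans Np (leq_addr _ _)).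
  rewrite (deltaS (p + k)) in IH *.
  have := ler_distD (u (p + k)%N) (u (p + k).+1) (u p); lra.
apply/cauchy_cvgP/cauchy_exP => e e0.
have [p Np pe] : exists2 p, (N <= p)%N & 2 * delta p < e.
  exists (N + Num.truncn e^-1).+1; first by rewrite leqW// leq_addr.
  rewrite -deltaS /delta -[ltRHS]invrK ltf_pV2 ?posrE ?invr_gt0 ?ltr0n ?expn_gt0//.
  apply: (lt_le_trans (truncnS_gt _)); rewrite ler_nat.
  by apply: leq_trans (ltn_expl _ (ltnSn 1)); rewrite ltnS leqW// leq_addl.
exists (u p); exists p => // m /= pm.
rewrite -ball_normE/= distrC -(subnKC pm).
by apply: le_lt_trans (cau _ _ Np) _; have := delta_gt0 (p + (m - p)); lra.
Qed.

Lemma mazur_ae : exists (h : nat -> R -> 'rV[R]_d) (l : R -> 'rV[R]_d),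
  [/\ forall m, midpoint_hull m (h m), vmeasurable setT l &
      {ae mu, forall x i, h m x 0 i @[m --> \oo] --> l x 0 i}].
Proof.
pose V k := [set q f | f in midpoint_hull k].
have qC k f : midpoint_hull k f -> 0 <= q f <= C ^+ 2 * fine (mu setT).
  move=> kf; have [mf fC] := midpoint_hull_bounded kf.
  rewrite Rintegral_ge0 => [/=|x _]; last exact: dotp_ge0.
  have := @norm_Rintegral_le _ _ _ mu setT measurableT muT
    (fun x => dotp (f x) (f x)) (C ^+ 2) (measurable_dotp mf).
  move=> /(_ _)/(le_trans (ler_norm _)); apply => x _.
  rewrite ger0_norm ?dotp_ge0// -sqr_enorm.
  by have := enorm_ge0 (f x); have := fC x; nra.
have infV k : has_inf (V k).
  split; first by exists (q (g k)), (g k) => //; exact: midpoint_hull_gen.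
  by exists 0 => _ [f /qC/andP[q0 _] <-].
pose c k := inf (V k).
have cC k : c k <= C ^+ 2 * fine (mu setT).
  have gk : midpoint_hull k (g k) by exact: midpoint_hull_gen.
  have /andP[_] := qC _ _ gk; apply: le_trans.
  by apply: (inf_lbound (infV k).2); exists (g k).
have cnd j k : (j <= k)%N -> c j <= c k.
  move=> jk; apply: lb_le_inf; first exact: (infV k).1.
  move=> _ [f kf <-]; apply: (inf_lbound (infV j).2); exists f => //.
  exact: midpoint_hullW kf.
pose W := range c.
have supW : has_sup W.
  by split; [exists (c 0%N), 0%N|exists (C ^+ 2 * fine (mu setT)) => _ [k _ <-]].
pose S := sup W.
have cS k : c k <= S by apply: (sup_upper_bound supW); exists k.
(* By the parallelogram identity, almost minimizers of the L^2 norm over the hulls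
   of the tails form a Cauchy sequence, chosen fast enough for Borel-Cantelli. *)
have /choice[h hP] : forall m, exists f, exists k,
    [/\ (m <= k)%N, midpoint_hull k f, S - delta m ^+ 3 < c k &
        q f < c k + delta m ^+ 3].
  move=> m; have d3 : 0 < delta m ^+ 3 by rewrite exprn_gt0.
  have [_ [k0 _ <-] k0S] := sup_adherent d3 supW.
  pose k := maxn m k0.
  have [_ [f kf <-] fk] := inf_adherent d3 (infV k).
  exists f, k; split => //; first exact: leq_maxl.
  by apply: (lt_le_trans k0S); apply: cnd; exact: leq_maxr.
have hm m : midpoint_hull m (h m).
  by have [k [mk kf _ _]] := hP m; exact: midpoint_hullW kf.
(* Both functions lie in the hull of tail [i] with [q] below [S + delta m ^+ 3], and their midpoint
   has [q] above [S - delta m ^+ 3]; the parallelogram identity leaves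
   [(2 + 2 + 4) delta m ^+ 3]. *)
have hq m : q (fun x => h m.+1 x - h m x) <= 8 * delta m ^+ 3.
  have [k [mk kf ck qk]] := hP m; have [j [mj jf cj qj]] := hP m.+1.
  have d3 : delta m.+1 ^+ 3 <= delta m ^+ 3.
    by rewrite lerXn2r ?nnegrE ?ltW// (deltaS m); have := delta_gt0 m.+1; lra.
  pose i := minn k j.
  have ci : S - delta m ^+ 3 < c i.
    rewrite /i /minn; case: ifP => // _; apply: le_lt_trans cj.
    by rewrite lerD2l lerN2.
  have if_ : midpoint_hull i (h m) by apply: midpoint_hullW kf; exact: geq_minl.
  have ih : midpoint_hull i (h m.+1) by apply: midpoint_hullW jf; exact: geq_minr.
  rewrite (q_sub ih if_).
  have : c i <= q (fun x => 2^-1 *: (h m.+1 x + h m x)).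
    apply: (inf_lbound (infV i).2); exists (fun x => 2^-1 *: (h m.+1 x + h m x)) => //.
    exact: midpoint_hull_mid.
  have := cS k; have := cS j; lra.
have mdiff m : vmeasurable setT (fun x => h m.+1 x - h m x).
  move=> i; rewrite (_ : (fun s => _) = (fun s => h m.+1 s 0 i - h m s 0 i)).
    have [mh1 _] := midpoint_hull_bounded (hm m.+1).
    have [mh _] := midpoint_hull_bounded (hm m).
    by apply: measurable_funB; [exact: mh1|exact: mh].
  by apply/funext => s; rewrite !mxE.
have diffC m x : enorm (h m.+1 x - h m x) <= C + C.
  rewrite (le_trans (ler_enormB _ _))// lerD//.
    by case: (midpoint_hull_bounded (hm m.+1)).
  by case: (midpoint_hull_bounded (hm m)).
(* Chebyshev at level [delta m ^+ 2] turns the bound [8 delta m ^+ 3] into the summable [8 delta m];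
   outside [Em m] consecutive terms differ by less than [delta m]. This explains the exponents 3 and
   2. *)
pose Em m : set (measurableTypeR R) :=
  [set x | delta m ^+ 2 <= dotp (h m.+1 x - h m x) (h m.+1 x - h m x)].
have mE m : measurable (Em m).
  rewrite -[Em m]setTI; have := measurable_dotp (mdiff m).
  move=> /(_ measurableT `[delta m ^+ 2, +oo[%classic) /(_ (measurable_itv _)).
  by rewrite set_itvcy.
have muE m : (mu (Em m) <= (8 / (2 ^ m.+1)%:R)%:E)%E.
  have muEfin : (mu (Em m) < +oo)%E.
    by apply: le_lt_trans muT; apply: le_measure; rewrite ?inE//.
  rewrite -(fineK (_ : mu (Em m) \is a fin_num)) ?ge0_fin_numE// lee_fin.
  rewrite -/(delta m).
  suff : delta m ^+ 2 * fine (mu (Em m)) <= delta m ^+ 2 * (8 * delta m).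
    by rewrite ler_pM2l// exprn_gt0.
  rewrite mulrCA -exprSr; apply: le_trans (hq m).
  rewrite -Rintegral_cst// Rintegral_mkcond; apply: le_Rintegral => //.
    have := @bounded_integrable _ _ _ mu (Em m) (mE m) muEfin
      (cst (delta m ^+ 2)) `|delta m ^+ 2|.
    by rewrite integrable_mkcond// restrict_EFin; apply.
  - exact: int_dotp (mdiff m) (diffC m).
  - move=> x _; rewrite patchE; case: ifPn => [|_]; last exact: dotp_ge0.
    by rewrite inE.
have sumE : (\sum_(m <oo) mu (Em m) < +oo)%E.
  apply: (@le_lt_trans _ _ (\sum_(m <oo) (8 / (2 ^ m.+1)%:R)%:E)%E).
    by apply: lee_nneseries => // m _; exact: muE.
  by apply: le_lt_trans (epsilon_trick0 xpredT _) _ => //; rewrite ltry.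
have mu0 := lim_sup_set_cvg0 mE sumE.
(* Taking a limsup makes [l] measurable on the whole line; it is the limit wherever the sequence
   converges. *)
pose l x : 'rV[R]_d := \row_i fine (limn_esup (fun m => (h m x 0 i)%:E)).
exists h, l; split => //.
  move=> i; rewrite (_ : (fun s => _) =
      fine \o (fun s => limn_esup (fun m => (h m s 0 i)%:E))); last first.
    by apply/funext => s; rewrite !mxE.
  apply: (measurableT_comp (fine_measurable measurableT)).
  apply: measurable_fun_limn_esup => m; apply/measurable_EFinP.
  by case: (midpoint_hull_bounded (hm m)) => + _; apply.
exists (lim_sup_set Em); split => //.
  by apply: bigcapT_measurable => k; apply: bigcup_measurable => m _; exact: mE.
move=> x /=; apply: contra_notP => nx i.
have [N NP] : exists N, forall m, (N <= m)%N -> ~ Em m x.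
  apply: contrapT => noN; apply: nx => N _; apply: contrapT => noE.
  by apply: noN; exists N => m Nm Emx; apply: noE; exists m.
have cv : cvgn (fun m => h m x 0 i).
  apply: (@fast_cauchy_cvg _ N) => m /NP /negP; rewrite -ltNge => lt.
  have -> : h m.+1 x 0 i - h m x 0 i = (h m.+1 x - h m x) 0 i by rewrite !mxE.
  apply: (le_trans (coord_le_enorm _ _)); apply: le_enorm_sqr; exact: ltW.
have ecv : (h m x 0 i)%:E @[m --> \oo] --> (limn (fun m => h m x 0 i))%:E.
  by apply: cvg_EFin; [exact: nearW|exact: cv].
by rewrite mxE (cvg_limn_einf_sup ecv).2.
Qed.

End mazur.

(** * Compactness *)

Section limits.
Context {R : realType}.

Lemma near_inv_natS (e : R) : 0 < e -> exists N, forall n, (N <= n)%N -> n.+1%:R^-1 <= e.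
Proof.
move=> e0; exists (Num.truncn e^-1) => n Nn.
rewrite -[leRHS]invrK lef_pV2 ?posrE ?invr_gt0//.
by apply: le_trans (ltW (truncnS_gt _)) _; rewrite ler_nat.
Qed.

Lemma cvg_of_inv_natS (u : nat -> R) l K :
  (forall n, `|u n - l| <= K * n.+1%:R^-1) -> u @ \oo --> l.
Proof.
move=> uK; have K0 : 0 <= K.
  by have := uK 0%N; rewrite invr1 mulr1; apply: le_trans.
have K1 : 0 < K + 1 by rewrite ltr_wpDl.
apply/cvgrPdistC_le => e e0.
have [N NP] := near_inv_natS (divr_gt0 e0 K1).
exists N => // n /= /NP ne; apply: (le_trans (uK n)).
apply: (le_trans (ler_wpM2l K0 ne)).
by rewrite mulrA ler_pdivrMr// mulrC ler_pM2l// lerDl.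
Qed.

Lemma cvg_rowV {d : nat} {T : Type} (F : set_system T) {FF : Filter F}
    (u : T -> 'rV[R]_d) (l : 'rV[R]_d) :
  (forall i, u x 0 i @[x --> F] --> l 0 i) -> u @ F --> l.
Proof.
move=> ul; apply/cvg_ballP => e e0.
have : \forall x \near F, forall i : 'I_d, ball (l 0 i) e (u x 0 i).
  apply: filter_forall => i.
  have /cvg_ballP := ul i; exact.
by apply: filterS => x ux; split => // i j; rewrite ord1; exact: ux.
Qed.

Lemma right_continuous_delta (f : R -> R) :
  (forall t : R, t \in `[0, 1[ -> f x @[x --> t^'+] --> f t) ->
  forall s e, 0 <= s <= 1 -> 0 < e ->
  exists2 dl, 0 < dl & forall x, s <= x -> x <= s + dl -> x <= 1 -> f x - f s <= e.
Proof.
move=> frc s e /andP[s0 s1] e0; have [s1'|s1'] := ltP s 1; last first.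
  exists 1 => // x sx _ x1; have -> : x = s.
    by apply/eqP; rewrite eq_le sx (le_trans x1).
  by rewrite subrr ltW.
have s01 : s \in `[0, 1[ by rewrite in_itv/= s0.
have /cvgrPdistC_le/(_ _ e0) := frc s s01.
rewrite near_withinE => -[dl /= dl0 H].
exists (dl / 2); first by rewrite divr_gt0.
move=> x sx xdl _; move: sx; rewrite le_eqVlt => /orP[/eqP <-|sx].
  by rewrite subrr ltW.
have := H x; rewrite /= ler0_norm ?subr_le0 ?(ltW sx)// => h.
by apply: le_trans (ler_norm _) _; apply: h => //; lra.
Qed.

(** An estimate relative to [phi] transfers both properties: the variation telescopes, and right
    continuity of [phi] is inherited. *)
Lemma BVRC_of_le {d : nat} (f : R -> 'rV[R]_d) (phi : R -> R) K :
  (forall t : R, t \in `[0, 1[ -> phi x @[x --> t^'+] --> phi t) ->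
  (forall s t, 0 <= s -> s <= t -> t <= 1 ->
     enorm (f t - f s) <= K * (phi t - phi s)) -> BVRC f.
Proof.
move=> phirc fK; split.
  exists (K * (phi 1 - phi 0)) => s s01; rewrite /vvariation.
  pose x n := nth 1 (0 :: s) n.
  have x0 n : (n <= size s)%N -> 0 <= x n <= 1.
    by move=> ns; rewrite (itv_partition_nth_ge _ s01)// (itv_partition_nth_le _ s01).
  apply: (@le_trans _ _ (\sum_(0 <= n < size s) K * (phi (x n.+1) - phi (x n)))).
    rewrite !big_mkord; apply: ler_sum => i _.
    have /andP[xi0 _] := x0 i (ltnW (ltn_ord i)).
    have /andP[_ xi1] := x0 i.+1 (ltn_ord i).
    apply: fK => //; apply/ltW.
    by case: s01 => /(pathP 1) /(_ i (ltn_ord i)).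
  rewrite -mulr_sumr telescope_sumr// /x (itv_partition_nth_size _ s01)//.
move=> t t01; apply: cvg_rowV => i.
have phi_t := phirc t t01.
apply/cvgrPdistC_le => e e0.
have K1 : 0 < `|K| + 1 by rewrite ltr_wpDl.
have /cvgrPdistC_le/(_ _ (divr_gt0 e0 K1)) := phi_t.
move=> H; near=> x.
have tx : t < x by near: x; exact: nbhs_right_gt.
have x1 : x < 1 by near: x; apply: nbhs_right_lt; have := t01; rewrite in_itv/= => /andP[].
have phix : `|phi x - phi t| <= e / (`|K| + 1) by near: x; exact: H.
have -> : f x 0 i - f t 0 i = (f x - f t) 0 i by rewrite !mxE.
apply: (le_trans (coord_le_enorm _ _)).
have t0 : 0 <= t by have := t01; rewrite in_itv/= => /andP[].
apply: (le_trans (fK t x t0 (ltW tx) (ltW x1))).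
apply: (le_trans (ler_norm _)); rewrite normrM.
apply: (le_trans (ler_wpM2l (normr_ge0 _) phix)).
by rewrite mulrA ler_pdivrMr// mulrC ler_pM2l// lerDl.
Unshelve. all: by end_near. Qed.

(* Arzela-Ascoli for functions that are, up to an error tending to 0, Lipschitz
   with respect to the distribution function phi. *)
Lemma uniform_subsequence (I : finType) (f : nat -> I -> R -> R) (phi : R -> R)
    (C K : R) : 0 <= K ->
  (forall n i s, `|f n i s| <= C) ->
  (forall e, 0 < e -> exists N t, grid phi e N t) ->
  (forall n i s t, 0 <= s -> s <= t -> t <= 1 ->
     `|f n i t - f n i s| <= K * (phi t - phi s + n.+1%:R^-1)) ->
  exists (g : I -> R -> R) (u : nat -> nat), [/\ forall j, (j <= u j)%N,
    forall j i t, 0 <= t <= 1 -> `|f (u j) i t - g i t| <= j.+1%:R^-1 &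
    forall i s t, 0 <= s -> s <= t -> t <= 1 ->
     `|g i t - g i s| <= K * (phi t - phi s)].
Proof.
move=> K0 fC gridP fK.
(* The cluster point is taken over all pairs [(i, t)] at once; it gives closeness at finitely many
   points, made uniform below by means of a grid. *)
have [g0 gP] := @bounded_cluster R (I * R)%type (fun n p => f n p.1 p.2) (fun=> C)
  (fun n p => fC n p.1 p.2).
pose g i t := g0 (i, t).
have gK i s t : 0 <= s -> s <= t -> t <= 1 -> `|g i t - g i s| <= K * (phi t - phi s).
  move=> s0 st t1; apply/ler_addgt0Pr => e e0.
  have [e1 e10 eE] : exists2 e1, 0 < e1 & K * e1 + 2 * e1 = e.
    exists (e / (K + 2)); first by rewrite divr_gt0// ltr_wpDl.
    by rewrite -mulrDl mulrC divfK// gt_eqF// ltr_wpDl.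
  have [N NP] := near_inv_natS e10.
  have [n Nn H] := gP [:: (i, s); (i, t)] _ N e10.
  have h1 : `|f n i s - g i s| < e1 by apply: (H (i, s)); rewrite mem_head.
  have h2 : `|f n i t - g i t| < e1 by apply: (H (i, t)); rewrite !inE eqxx orbT.
  have h3 := fK n i s t s0 st t1.
  have h4 := ler_wpM2l K0 (NP n Nn).
  have h5 := ler_distD (f n i t) (g i t) (g i s).
  have h6 := ler_distD (f n i s) (f n i t) (g i s).
  rewrite mulrDr in h3; rewrite (distrC (g i t) (f n i t)) in h5.
  move: h3 h4; move: (_^-1 : R) => w h3 h4; lra.
have unif j : exists n, (j <= n)%N /\
    forall i t, 0 <= t <= 1 -> `|f n i t - g i t| <= j.+1%:R^-1.
  set e : R := j.+1%:R^-1; have e0 : 0 < e by rewrite invr_gt0.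
  have K4 : 0 < 4 * (K + 1) by rewrite mulr_gt0// ltr_wpDl.
  pose dl := e / (4 * (K + 1)).
  have dl0 : 0 < dl by rewrite divr_gt0.
  have Kdl : K * dl <= e / 4.
    by rewrite /dl mulrA ler_pdivrMr//; nra.
  clearbody dl; clearbody e.
  have [N [t gt]] := gridP _ dl0.
  have [N1 N1P] := near_inv_natS dl0.
  have e4 : 0 < e / 4 by rewrite divr_gt0.
  (* Closeness at the nodes costs [e / 4]. From the left node of a cell, [f n] moves by at most
     [K (dl + dl) <= e / 2] and [g] by at most [K dl <= e / 4]. *)
  have [n Nn H] := gP [seq (i, t k) | i <- enum I, k <- iota 0 N.+1] _ (maxn j N1) e4.
  exists n; split; first by rewrite (leq_trans (leq_maxl _ _) Nn).
  move=> i s /[dup] s01 /andP[s0 s1].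
  have nd := ler_wpM2l K0 (N1P n (leq_trans (leq_maxr _ _) Nn)).
  set k := cell N t s.
  have tk0 : 0 <= t k by case: gt => _ _ _ /(_ k) /andP[].
  have tks := t_cell_le gt s0.
  have near_ := ler_wpM2l K0 (t_cell_near gt s01 (ltW dl0)).
  have h1 := fK n i (t k) s tk0 tks s1.
  have h2 := gK i (t k) s tk0 tks s1.
  have h3 : `|f n i (t k) - g i (t k)| < e / 4.
    apply: (H (i, t k)); apply: allpairs_f; first by rewrite mem_enum.
    by rewrite mem_iota/= add0n ltnS cell_le.
  rewrite mulrDr in h1.
  have h4 := ler_distD (f n i (t k)) (f n i s) (g i s).
  have h5 := ler_distD (g i (t k)) (f n i (t k)) (g i s).
  rewrite (distrC (g i (t k)) (g i s)) in h5.
  rewrite -/k in near_; move: h1 nd; move: (n.+1%:R^-1 : R) => w h1 nd; lra.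
have /choice[u uP] := unif.
by exists g, u; split => // j; [case: (uP j)|case: (uP j)].
Qed.

End limits.

(** * Passing to the limit *)

Section limit_solution.
Context {R : realType} {d : nat}.
Local Notation E := 'rV[R]_d.
Implicit Types s t : R.
Variables (A : R -> E -> set E) (r : R -> R) (M : R) (b : R -> E -> E) (y0 : E).
Hypothesis A_maxmon : forall t, t \in `[0, 1] -> maximal_monotone (A t).
Hypothesis r_rc : forall t : R, t \in `[0, 1[ -> r x @[x --> t^'+] --> r t.
Hypothesis r_nd : {in `[0, 1] &, {homo r : s t / s <= t}}.
Hypothesis dis_le : forall s t, 0 <= s -> s <= t -> t <= 1 ->
      (dis (A t) (A s) <= (r t - r s)%:E)%E.
Hypothesis b_bnd : forall t x, t \in `[0, 1] -> enorm (b t x) <= M.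
Hypothesis b_cont : forall t, t \in `[0, 1] -> continuous (b t).

Local Notation lambda := (@lebesgue_measure R).
Local Notation nu := (nu r_nd r_rc).
Local Notation phi := (clock r).

Variables (C : R) (Bb Yb Qb Yt ab : nat -> R -> E) (th : nat -> R -> R) (B Q : R -> E).
Variable K : R.
Hypothesis C_ge0 : 0 <= C.
Hypothesis ap : forall j, approx_solution A b y0 r_rc r_nd j.+1%:R^-1 C
  (Bb j) (Yb j) (Qb j) (Yt j) (ab j) (th j).
Hypothesis cvB : forall j t, t \in `[0, 1] -> enorm (Bb j t - B t) <= d%:R * j.+1%:R^-1.
Hypothesis cvQ : forall j t, t \in `[0, 1] -> enorm (Qb j t - Q t) <= d%:R * j.+1%:R^-1.
Hypothesis BK : forall s t, 0 <= s -> s <= t -> t <= 1 ->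
  enorm (B t - B s) <= K * (phi t - phi s).
Hypothesis QK : forall s t, 0 <= s -> s <= t -> t <= 1 ->
  enorm (Q t - Q s) <= K * (phi t - phi s).

Let I01 t : 0 <= t -> t <= 1 -> t \in `[0, 1].
Proof. by move=> t0 t1; rewrite in_itv/= t0. Qed.

Let sub01 x (t : R) : t \in `[0, 1] ->
  [set` Interval (BSide x 0) (BSide x t)] `<=` `[0, 1]%classic.
Proof.
rewrite in_itv/= => /andP[t0 t1].
by apply: subset_itv; case: x; rewrite bnd_simp.
Qed.

Let vmeasurableS x t (f : R -> E) : t \in `[0, 1] -> vmeasurable `[0, 1]%classic f ->
  vmeasurable [set` Interval (BSide x 0) (BSide x t)] f.
Proof.
by move=> t01 mf i; apply: (measurable_funS _ (sub01 t01)) => //; exact: mf.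
Qed.

Let coord_cvg (u : nat -> E) l k : (forall j, enorm (u j - l) <= k * j.+1%:R^-1) ->
  forall i, u j 0 i @[j --> \oo] --> l 0 i.
Proof.
move=> ul i; apply: (@cvg_of_inv_natS _ _ _ k) => j.
have -> : u j 0 i - l 0 i = (u j - l) 0 i by rewrite !mxE.
exact: le_trans (coord_le_enorm _ _) (ul j).
Qed.

Let cvBi t i : t \in `[0, 1] -> Bb j t 0 i @[j --> \oo] --> B t 0 i.
Proof. by move=> t01; apply: coord_cvg => j; exact: cvB. Qed.

Let cvQi t i : t \in `[0, 1] -> Qb j t 0 i @[j --> \oo] --> Q t 0 i.
Proof. by move=> t01; apply: coord_cvg => j; exact: cvQ. Qed.

Let vmeasurable_lim (f : nat -> R -> E) (g : R -> E) :
  (forall j, vmeasurable `[0, 1]%classic (f j)) ->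
  (forall t i, t \in `[0, 1] -> f j t 0 i @[j --> \oo] --> g t 0 i) ->
  vmeasurable `[0, 1]%classic g.
Proof.
move=> mf fg i; apply/measurable_EFinP.
apply: (emeasurable_fun_cvg (fun j (t : measurableTypeR R) => (f j t 0 i)%:E)).
  by move=> j; apply/measurable_EFinP; exact: mf.
by move=> t t01; apply: cvg_EFin; [exact: nearW|exact: fg].
Qed.

Let mB : vmeasurable `[0, 1]%classic B.
Proof. exact: vmeasurable_lim (fun j => ap_Bmeas (ap j)) cvBi. Qed.

Let BC t : t \in `[0, 1] -> enorm (B t) <= C + d%:R.
Proof.
move=> t01; have -> : B t = Bb 0%N t - (Bb 0%N t - B t) by rewrite opprB addrC subrK.
apply: (le_trans (ler_enormB _ _)); apply: lerD; first exact: (ap_B (ap 0%N)).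
by have := cvB 0%N t01; rewrite invr1 mulr1.
Qed.

Let lambda_lty t : t \in `[0, 1] -> (lambda `[0%R, t[%classic < +oo)%E.
Proof.
by rewrite in_itv/= => /andP[t0 _]; rewrite lebesgue_measure_itvco ?ltry.
Qed.

Let vint_cvg (f : nat -> R -> E) (g : R -> E) k t i : t \in `[0, 1] ->
  (forall j, vmeasurable `[0, 1]%classic (f j)) -> 
  (forall t i, t \in `[0, 1] -> f j t 0 i @[j --> \oo] --> g t 0 i) ->
  (forall j s, s \in `[0, 1] -> enorm (f j s) <= k) ->
  vintegral lambda `[0, t[%classic (f j) 0 i @[j --> \oo] -->
  vintegral lambda `[0, t[%classic g 0 i.
Proof.
move=> t01 mf fg fk.
have mg := vmeasurable_lim mf fg.
rewrite !mxE; under eq_fun do rewrite mxE.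
have lfin := lambda_lty t01.
apply: (@bounded_convergence _ _ _ lambda `[0, t[%classic (measurable_itv _) lfin
  (fun j s => f j s 0 i) (fun s => g s 0 i) k _ _ _ _).2.
- by move=> n; exact: (@vmeasurableS true _ _ t01 (mf n) i).
- exact: (@vmeasurableS true _ _ t01 mg i).
- move=> n x /(sub01 (x := true) t01) x01.
  exact: le_trans (coord_le_enorm _ _) (fk n x x01).
- by apply: aeW => x /(sub01 (x := true) t01) x01; exact: fg.
Qed.

(** Open at [t] to match the left-closed cells of the scheme; Lebesgue measure ignores the
    endpoint. *)
Definition drift t : E := vintegral lambda `[0, t[%classic B.
Local Notation D := drift.
Local Notation Y := (fun t => Q t - D t).
Local Notation X := (fun t => B t + (Q t - D t)).

(** The limit of [Yb] is deduced from those of [Qb] and of the integral of [Bb], the latter by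
    bounded convergence. *)
Let cvYi t i : t \in `[0, 1] -> Yb j t 0 i @[j --> \oo] --> (Q t - D t) 0 i.
Proof.
move=> t01.
have h1 : (Qb j t - Yb j t - vintegral lambda `[0, t[%classic (Bb j)) 0 i
    @[j --> \oo] --> (0 : E) 0 i.
  by apply: coord_cvg => j; rewrite subr0; exact: (ap_Deq (ap j) t01).
have h2 : vintegral lambda `[0, t[%classic (Bb j) 0 i @[j --> \oo] --> D t 0 i.
  apply: vint_cvg t01 (fun j => ap_Bmeas (ap j)) cvBi _ => j s _.
  exact: (ap_B (ap j)).
have E1 j : Yb j t 0 i = Qb j t 0 i - vintegral lambda `[0, t[%classic (Bb j) 0 i -
    (Qb j t - Yb j t - vintegral lambda `[0, t[%classic (Bb j)) 0 i.
  by rewrite !mxE; ring.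
have -> : (Q t - D t) 0 i = Q t 0 i - D t 0 i - (0 : E) 0 i by rewrite !mxE subr0.
rewrite (funext E1); exact: (cvgB (cvgB (@cvQi t i t01) h2) h1).
Qed.

Let cvXi t i : t \in `[0, 1] -> (Bb j t + Yb j t) 0 i @[j --> \oo] --> X t 0 i.
Proof.
move=> t01; have E1 j : (Bb j t + Yb j t) 0 i = Bb j t 0 i + Yb j t 0 i.
  by rewrite mxE.
rewrite (funext E1) mxE; exact: cvgD (@cvBi t i t01) (@cvYi t i t01).
Qed.

Let cvbi t i : t \in `[0, 1] ->
  b t (Bb j t + Yb j t) 0 i @[j --> \oo] --> b t (X t) 0 i.
Proof.
move=> t01.
have cvX : (Bb j t + Yb j t) @[j --> \oo] --> X t by apply: cvg_rowV => k; exact: cvXi.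
have cvb : b t (Bb j t + Yb j t) @[j --> \oo] --> b t (X t).
  by apply: continuous_cvg cvX; exact: b_cont.
have coord_i : {for b t (X t), continuous (fun v : E => v 0 i)} by exact: coord_continuous.
by have := continuous_cvg _ coord_i cvb; exact.
Qed.

Let mb : vmeasurable `[0, 1]%classic (fun t => b t (X t)).
Proof.
apply: (@vmeasurable_lim (fun j t => b t (Bb j t + Yb j t))) => [j|t i].
  exact: (ap_bmeas (ap j)).
exact: cvbi.
Qed.

Lemma limit_velocity t : t \in `[0, 1] ->
  B t = vintegral lambda `[0, t]%classic (fun s => b s (X s)).
Proof.
move=> t01; have /andP[t0 t1] : 0 <= t <= 1 by have := t01; rewrite in_itv.
apply/rowP => i.
have -> : vintegral lambda `[0, t]%classic (fun s => b s (X s)) 0 i =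
    vintegral lambda `[0, t[%classic (fun s => b s (X s)) 0 i.
  rewrite !mxE -Rintegral_itv_bndo_bndc//.
  apply: (@vmeasurable_integrable R d lambda `[0, t[%classic
    (fun s => b s (X s)) M i (measurable_itv _) (lambda_lty t01)).
    exact: (@vmeasurableS true _ _ t01 mb).
  by move=> x /(sub01 (x := true) t01) x01; exact: b_bnd.
have h1 : (Bb j t - vintegral lambda `[0, t[%classic (fun s => b s (Bb j s + Yb j s))) 0 i
    @[j --> \oo] --> (0 : E) 0 i.
  by apply: coord_cvg => j; rewrite subr0; exact: (ap_Beq (ap j) t01).
have h2 : vintegral lambda `[0, t[%classic (fun s => b s (Bb j s + Yb j s)) 0 i
    @[j --> \oo] --> vintegral lambda `[0, t[%classic (fun s => b s (X s)) 0 i.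
  apply: (@vint_cvg _ _ M _ _ t01 (fun j => ap_bmeas (ap j)) cvbi).
  by move=> j s s01; exact: b_bnd.
have E1 j : Bb j t 0 i =
    (Bb j t - vintegral lambda `[0, t[%classic (fun s => b s (Bb j s + Yb j s))) 0 i +
    vintegral lambda `[0, t[%classic (fun s => b s (Bb j s + Yb j s)) 0 i.
  by rewrite !mxE; ring.
have := @cvBi t i t01; rewrite (funext E1) => cvBt.
by have := cvg_unique _ cvBt (cvgD h1 h2); rewrite [(0 : E) 0 i]mxE add0r; exact.
Qed.

Let enorm_cvg (u : nat -> E) (l : E) e :
  (forall i, u j 0 i @[j --> \oo] --> l 0 i) -> 0 < e ->
  exists J, forall j, (J <= j)%N -> enorm (u j - l) <= e.
Proof.
move=> ul e0; have e'0 : 0 < e / d.+1%:R by rewrite divr_gt0.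
have : \forall j \near \oo, forall i : 'I_d, `|u j 0 i - l 0 i| <= e / d.+1%:R.
  by apply: filter_forall => i; have /cvgrPdistC_le/(_ _ e'0) := ul i.
move=> [J _ JP]; exists J => j /JP uj.
apply: (le_trans (@enorm_le_coord _ _ _ (e / d.+1%:R) _)).
  by move=> i; rewrite !mxE; exact: uj.
by rewrite mulrCA ler_piMr ?(ltW e0)// ler_pdivrMr// mul1r ler_nat.
Qed.

(** The nodes [th j s] approach [s] from the right, which is why right continuity suffices. *)
Let th_near (f : R -> R) s e :
  (forall t : R, t \in `[0, 1[ -> f x @[x --> t^'+] --> f t) ->
  s \in `[0, 1] -> 0 < e ->
  exists J, forall j, (J <= j)%N -> f (th j s) - f s <= e.
Proof.
move=> frc s01 e0; have s01' : 0 <= s <= 1 by have := s01; rewrite in_itv.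
have [dl dl0 dlP] := right_continuous_delta frc s01' e0.
have [J JP] := near_inv_natS dl0; exists J => j /JP jdl.
have [_ sth ths th1] := ap_graph (ap j) s01.
by apply: dlP => //; apply: (le_trans ths); rewrite lerD2l.
Qed.

Let Yt_near s e : s \in `[0, 1] -> 0 < e ->
  exists J, forall j, (J <= j)%N -> enorm (Yt j s - Y s) <= e.
Proof.
move=> s01 e0; have [e1 [e10 Ce1]] : exists e1, 0 < e1 /\ C * (e1 + e1) + e1 <= e.
  exists (e / (2 * C + 1)); have C1 : 0 < 2 * C + 1 by rewrite ltr_wpDl// mulr_ge0.
  rewrite divr_gt0//; split => //.
  suff -> : C * (e / (2 * C + 1) + e / (2 * C + 1)) + e / (2 * C + 1) = e by [].
  by field; rewrite gt_eqF.
have [J1 J1P] := th_near (phi_rc r_rc) s01 e10.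
have [J2 J2P] := near_inv_natS e10.
have [J3 J3P] := enorm_cvg (fun i => @cvYi s i s01) e10.
exists (maxn J1 (maxn J2 J3)) => j; rewrite !geq_max => /and3P[/J1P h1 /J2P h2 /J3P h3].
have h4 := ap_Y (ap j) s01.
apply: (le_trans (ler_enorm_distD (Yb j s) _ _)).
apply: le_trans _ Ce1; apply: lerD h3; apply: (le_trans h4).
by rewrite ler_wpM2l// lerD.
Qed.

(** [ab j s] belongs to the operator at time [th j s], not [s]. The pseudo-distance replaces
    monotonicity at a cost of at most [r (th j s) - r s] times [1 + C + |y|], which vanishes by
    right continuity of [r]. *)
Let graph_near s x y e : s \in `[0, 1] -> A s x y -> 0 < e ->
  exists J, forall j, (J <= j)%N -> - e <= dotp (ab j s - y) (Y s - x).
Proof.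
move=> s01 xy e0; have /andP[s0 s1] : 0 <= s <= 1 by have := s01; rewrite in_itv.
pose k := 1 + C + enorm y.
have k0 : 0 < k by rewrite /k -addrA ltr_pwDl// addr_ge0// enorm_ge0.
have e20 : 0 < e / (2 * k) by rewrite divr_gt0// mulr_gt0.
have ke : e / (2 * k) * k = e / 2 by field; rewrite gt_eqF.
have [J1 J1P] := th_near r_rc s01 e20.
have [J2 J2P] := Yt_near s01 e20.
exists (maxn J1 J2) => j; rewrite geq_max => /andP[/J1P h1 /J2P h2].
have [Aj sth _ th1] := ap_graph (ap j) s01.
have aC := ap_a (ap j) s.
have h3 := dis_graph dis_le s0 sth th1 Aj xy.
have r_le : r s <= r (th j s).
  by apply: r_nd => //; apply: I01 => //; exact: le_trans sth.
have h4 : (r (th j s) - r s) * (1 + enorm (ab j s) + enorm y) <= e / 2.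
  rewrite -ke; apply: ler_pM => //; first by rewrite subr_ge0.
    by rewrite !addr_ge0 ?enorm_ge0.
  by rewrite lerD2r lerD2l.
have h5 : `|dotp (ab j s - y) (Yt j s - Y s)| <= e / 2.
  apply: (le_trans (norm_dotp_le _ _)); rewrite mulrC -ke.
  apply: ler_pM; rewrite ?enorm_ge0//.
  rewrite (le_trans (ler_enormB _ _))// lerD2r (le_trans aC)// lerDr ler01//.
have : dotp (ab j s - y) (Y s - x) = - dotp (ab j s - y) (x - Yt j s) -
    dotp (ab j s - y) (Yt j s - Y s).
  by rewrite !dotpE; ring.
move: h5; rewrite ler_norml => /andP[_ h5] ->; lra.
Qed.

(** Stated at a fixed [s] for any limit of hull elements because it serves twice: for cluster points
    of [ab j s], at every [s], and for the Mazur limit, at almost every [s]. *)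
Let limit_graph s (a : E) : s \in `[0, 1] ->
  (forall e J, 0 < e -> exists2 f, midpoint_hull ab J f & enorm (f s - a) <= e) ->
  A s (Y s) a.
Proof.
move=> s01 aP; apply: maximal_monotone_mem; first exact: A_maxmon.
move=> x y xy; apply: (@ge0_of_eps _ _ (1 + enorm (Y s - x))).
  by rewrite addr_ge0 ?enorm_ge0.
move=> e e0; have [J JP] := graph_near s01 xy e0.
have [f Jf fa] := aP e J e0.
have fe : - e <= dotp (f s - y) (Y s - x).
  elim: Jf => [j /JP //|f1 f2 _ h1 _ h2].
  by move: h1 h2; rewrite !dotpE; lra.
have : `|dotp (f s - a) (Y s - x)| <= e * enorm (Y s - x).
  by rewrite (le_trans (norm_dotp_le _ _))// ler_wpM2r ?enorm_ge0.
rewrite ler_norml => /andP[_ h].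
have -> : dotp (a - y) (Y s - x) = dotp (f s - y) (Y s - x) - dotp (f s - a) (Y s - x).
  by rewrite !dotpE; ring.
lra.
Qed.

(** The domain condition must hold at every [s], including the null set where the density is not
    controlled; a cluster point of the bounded [ab j s] provides an element of [A s (Y s)]. *)
Lemma limit_dom s : s \in `[0, 1] -> dom (A s) (Y s).
Proof.
move=> s01; have [a aP] := bounded_enorm_cluster (fun j => ap_a (ap j) s).
exists a; apply: limit_graph => // e J e0.
have [n Jn na] := aP e J e0.
by exists (ab n) => //; exact: midpoint_hull_gen.
Qed.

Let ab_measurable j : vmeasurable setT (ab j). Proof. exact: (ap_ameas (ap j)). Qed.
Let ab_bounded j s : enorm (ab j s) <= C. Proof. exact: (ap_a (ap j)). Qed.

(** The relation between [Q] and the integral of [ab j] is affine in [ab j] with an error tending to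
    0, so it persists on the hulls of the tails and passes to [l] by bounded convergence. *)
Lemma limit_density : exists l : R -> E,
  [/\ forall i, nu.-integrable `[0, 1]%classic (fun s => (l s 0 i)%:E),
      forall t, t \in `[0, 1] -> Q t = y0 - vintegral nu `]0, t]%classic l &
      {ae nu, forall s, s \in `[0, 1] -> A s (Y s) (l s)}].
Proof.
have nuT : (nu setT < +oo)%E by exact: nu_lty.
have ae_imply (P1 P2 : R -> Prop) : (forall s, P1 s -> P2 s) ->
    {ae nu, forall s, P1 s} -> {ae nu, forall s, P2 s}.
  move=> P12 [N [mN N0 PN]]; exists N; split => //.
  by apply: subset_trans PN => s /= nP2 /P12.
have [h [l [hh ml hl]]] := mazur_ae nuT ab_measurable ab_bounded.
have hm m : vmeasurable setT (h m) /\ forall x, enorm (h m x) <= C.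
  exact: midpoint_hull_bounded ab_measurable ab_bounded _ _ (hh m).
have cvh V i : measurable V ->
    nu.-integrable V (EFin \o (fun s => l s 0 i)) /\
    (\int[nu]_(x in V) h m x 0 i @[m --> \oo] --> \int[nu]_(x in V) l x 0 i).
  move=> mV; apply: (@bounded_convergence _ _ _ nu V mV (nu_lty _ _ mV)
    (fun m x => h m x 0 i) _ C).
  - by move=> n; apply: measurable_funTS; exact: (hm n).1.
  - by apply: measurable_funTS; exact: ml.
  - by move=> n x _; exact: le_trans (coord_le_enorm _ _) ((hm n).2 x).
  - by apply: ae_imply hl => x + _; exact.
exists l; split.
- by move=> i; exact: (cvh _ i (measurable_itv _)).1.
- move=> t t01; apply/rowP => i; rewrite !mxE.
  pose I (f : R -> E) := \int[nu]_(x in `]0, t]) f x 0 i.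
  suff : y0 0 i - Q t 0 i = I l by rewrite /I => <-; ring.
  have II f1 f2 : vmeasurable setT f1 /\ (forall x, enorm (f1 x) <= C) ->
      vmeasurable setT f2 /\ (forall x, enorm (f2 x) <= C) ->
      I (fun x => 2^-1 *: (f1 x + f2 x)) = 2^-1 * (I f1 + I f2).
    move=> [mf1 f1C] [mf2 f2C].
    have int f : vmeasurable setT f -> (forall x, enorm (f x) <= C) ->
        nu.-integrable `]0, t]%classic (EFin \o (fun s => f s 0 i)).
      move=> mf fC; apply: (@vmeasurable_integrable _ _ _ _ f C) => //.
      - exact: nu_lty.
      - by move=> k; apply: measurable_funTS; exact: mf.
    rewrite /I -RintegralD//; [|exact: int|exact: int].
    rewrite -RintegralZl//; first by apply: eq_Rintegral => x _; rewrite !mxE.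
    rewrite (_ : _ \o _ = ((EFin \o (fun s => (f1 s 0 i)%R)) \+
      (EFin \o (fun s => (f2 s 0 i)%R)))%E)//.
    by apply: integrableD => //; exact: int.
  have Iab e : 0 < e -> exists J, forall j, (J <= j)%N ->
      `|y0 0 i - Q t 0 i - I (ab j)| <= e.
    move=> e0; have Cd : 0 < C + d%:R + 1 by rewrite ltr_wpDl// addr_ge0.
    have [J JP] := near_inv_natS (divr_gt0 e0 Cd); exists J => j /JP je.
    have h1 := le_trans (coord_le_enorm _ i) (ap_Qeq (ap j) t01).
    have h2 := le_trans (coord_le_enorm _ i) (cvQ j t01).
    rewrite !mxE -/(I (ab j)) in h1 h2.
    have je' := ler_wpM2l (addr_ge0 C_ge0 (ler0n R d)) je.
    have le_e : (C + d%:R) * (e / (C + d%:R + 1)) <= e.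
      by rewrite mulrA ler_pdivrMr//; nra.
    have h3 := ler_normD (y0 0 i - Qb j t 0 i - I (ab j)) (Qb j t 0 i - Q t 0 i).
    have -> : y0 0 i - Q t 0 i - I (ab j) =
      y0 0 i - Qb j t 0 i - I (ab j) + (Qb j t 0 i - Q t 0 i) by ring.
    apply: (le_trans h3); apply: le_trans _ le_e; apply: le_trans _ je'.
    by rewrite mulrDl lerD.
  apply/eqP; rewrite -subr_eq0 -normr_le0; apply/ler_addgt0Pr => e e0.
  have e20 : 0 < e / 2 by rewrite divr_gt0.
  have [J JP] := Iab _ e20.
  have hull f : midpoint_hull ab J f -> `|y0 0 i - Q t 0 i - I f| <= e / 2.
    elim=> [j /JP//|f1 f2 H1 h1 H2 h2]; rewrite II; last 2 first.
    - exact: midpoint_hull_bounded ab_measurable ab_bounded _ _ H1.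
    - exact: midpoint_hull_bounded ab_measurable ab_bounded _ _ H2.
    move: h1 h2; rewrite !ler_norml => /andP[a1 b1] /andP[a2 b2].
    by apply/andP; split; lra.
  have /cvgrPdistC_le/(_ _ e20)[J1 _ J1P] :=
    (cvh _ i (measurable_itv `]0, t])).2.
  pose m := maxn J J1.
  have h1 : `|y0 0 i - Q t 0 i - I (h m)| <= e / 2.
    by apply: hull; apply: midpoint_hullW (hh m); exact: leq_maxl.
  have h2 : `|I (h m) - I l| <= e / 2 by apply: J1P; exact: leq_maxr.
  have h3 := ler_normD (y0 0 i - Q t 0 i - I (h m)) (I (h m) - I l).
  rewrite addrA subrK in h3; rewrite add0r; lra.
- apply: ae_imply hl => s hls s01; apply: limit_graph => // e J e0.
  have [J1 J1P] := enorm_cvg hls e0.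
  exists (h (maxn J J1)); last by apply: J1P; exact: leq_maxr.
  by apply: midpoint_hullW (hh _); exact: leq_maxl.
Qed.

Local Notation dln := (dlambda_dnu r_nd r_rc).
Local Notation RN := (Radon_Nikodym (charge_of_finite_measure (@lambdaI R)) nu).

Let dlnE t : (dln t)%:E = RN t.
Proof.
rewrite /dlambda_dnu fineK//; apply: Radon_Nikodym_fin_num.
exact: lambdaI_dominated.
Qed.

Let dlnB_integrable i :
  nu.-integrable `[0, 1]%classic (fun s => (dln s * B s 0 i)%:E).
Proof.
have mI : measurable (`[0, 1]%classic : set (measurableTypeR R)) by exact: measurable_itv.
have iRN : nu.-integrable `[0, 1]%classic RN.
  apply: (integrableS measurableT) => //; apply: Radon_Nikodym_integrable.
  exact: lambdaI_dominated.
have -> : (fun s => (dln s * B s 0 i)%:E) = (RN \* (EFin \o (fun s => (B s 0 i)%R)))%E.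
  by apply/funext => s; rewrite EFinM dlnE.
apply: integrableMl; [exact: mI|exact: iRN| |]; [exact: (mB i)|].
exists (C + d%:R); split; first exact: num_real.
move=> k Ck s s01; apply: (@le_trans _ _ (C + d%:R)); last exact: ltW.
exact: le_trans (coord_le_enorm _ _) (BC s01).
Qed.

Let drift_density t i : t \in `[0, 1] ->
  D t 0 i = \int[nu]_(x in `]0, t]) (dln x * B x 0 i).
Proof.
move=> t01; have /andP[t0 t1] : 0 <= t <= 1 by have := t01; rewrite in_itv.
have sub := @sub01 false t t01.
have iB : (@lambdaI R).-integrable `]0, t]%classic (EFin \o (fun s => B s 0 i)).
  apply: (@bounded_integrable _ _ _ (@lambdaI R) _ (measurable_itv _) _ _ (C + d%:R)).
  - by rewrite ltey_eq fin_num_measure//; exact: measurable_itv.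
  - exact: (@vmeasurableS false _ _ t01 mB).
  - by move=> x /sub x01; exact: le_trans (coord_le_enorm _ _) (BC x01).
have lfin : (lambda `]0%R, t]%classic < +oo)%E.
  by rewrite lebesgue_measure_itv/=; case: ifP => // _; rewrite -EFinB ltry.
have iB' : lambda.-integrable `]0, t]%classic (EFin \o (fun s => B s 0 i)).
  apply: (@bounded_integrable _ _ _ lambda _ (measurable_itv _) lfin _ (C + d%:R)).
  - exact: (@vmeasurableS false _ _ t01 mB).
  - by move=> x /sub x01; exact: le_trans (coord_le_enorm _ _) (BC x01).
have iB2 : lambda.-integrable `[0, t[%classic (EFin \o (fun s => B s 0 i)).
  apply: (@bounded_integrable _ _ _ lambda _ (measurable_itv _) (lambda_lty t01) _ (C + d%:R)).
  - exact: (@vmeasurableS true _ _ t01 mB).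
  - move=> x /(sub01 (x := true) t01) x01.
    exact: le_trans (coord_le_enorm _ _) (BC x01).
(* The endpoints are exchanged under Lebesgue measure, before the passage to [nu], which may charge
   [t]. *)
rewrite mxE Rintegral_itv_bndo_bndc// -Rintegral_itv_obnd_cbnd//.
rewrite /Rintegral; congr fine.
under [RHS]eq_integral do rewrite mulrC EFinM dlnE.
rewrite (Radon_Nikodym_change_of_variables (@lambdaI_dominated R r r_nd r_rc) _ iB)//.
apply: eq_measure_integral => V mV Vt.
have VI : V `&` `[0, 1]%classic = V by apply: setIidl; exact: subset_trans sub.
by have := congr1 lambda VI; exact.
Qed.

Lemma drift_le s t : 0 <= s -> s <= t -> t <= 1 ->
  enorm (D t - D s) <= d%:R * ((C + d%:R) * (t - s)).
Proof.
move=> s0 st t1.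
have lebI x y : 0 <= x -> x <= y -> y <= 1 -> lambda `[x, y[%classic = (y - x)%:E.
  by move=> _ xy _; exact: lebesgue_measure_itvco.
have := @enorm_vintegral_itv_le R d lambda true id lebI B (C + d%:R) mB BC s t s0 st t1.
have := @vintegral_additive R d lambda true id lebI B (C + d%:R) mB BC 0 s t
  (lexx 0) s0 st t1.
by rewrite /drift => ->; rewrite addrAC subrr add0r.
Qed.

Lemma limit_is_solution :
  let Bt t := vintegral lambda `[0, t]%classic (fun s => b s (X s)) in
  [/\ BVRC X /\ BVRC Y, X 0 = y0 /\ Y 0 = y0,
      forall t, t \in `[0, 1] -> X t = Bt t + Y t,
      forall t, t \in `[0, 1] -> dom (A t) (Y t) &
      exists2 dY : R -> E, is_density r_nd r_rc Y dY &
        {ae nu, forall t, t \in `[0, 1] ->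
          exists2 a, A t (Y t) a & - dY t = a + dln t *: Bt t}].
Proof.
move=> Bt.
have Bint t : t \in `[0, 1] -> Bt t = B t by move=> t01; rewrite limit_velocity.
have [l [il Ql Al]] := limit_density.
have z01 : (0 : R) \in `[0, 1] by rewrite in_itv/= lexx ler01.
have B0 : B 0 = 0.
  rewrite -Bint// /Bt; apply/rowP => i; rewrite !mxE set_itv1.
  exact: Rintegral_set1.
have D0 : D 0 = 0 by rewrite /drift set_itvxx vintegral_set0.
have Q0 : Q 0 = y0 by rewrite Ql// set_itvxx vintegral_set0 subr0.
have dC0 : 0 <= d%:R * (C + d%:R) by rewrite mulr_ge0// addr_ge0.
have YK s t : 0 <= s -> s <= t -> t <= 1 ->
    enorm (Y t - Y s) <= (K + d%:R * (C + d%:R)) * (phi t - phi s).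
  move=> s0 st t1; have h1 := QK s0 st t1; have h2 := drift_le s0 st t1.
  have h3 := ler_wpM2l dC0 (phi_increase r_nd s0 st t1).
  have -> : Y t - Y s = (Q t - Q s) - (D t - D s) by rewrite !opprD !opprK addrACA.
  by apply: (le_trans (ler_enormB _ _)); lra.
have XK s t : 0 <= s -> s <= t -> t <= 1 ->
    enorm (X t - X s) <= (K + (K + d%:R * (C + d%:R))) * (phi t - phi s).
  move=> s0 st t1; have h1 := BK s0 st t1; have h2 := YK s t s0 st t1.
  have -> : X t - X s = (B t - B s) + (Y t - Y s) by rewrite opprD addrACA.
  by apply: (le_trans (ler_enormD _ _)); lra.
split.
- by split; [exact: BVRC_of_le (phi_rc r_rc) XK|exact: BVRC_of_le (phi_rc r_rc) YK].
- by rewrite B0 D0 Q0 subr0 add0r.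
- by move=> t t01; rewrite Bint.
- exact: limit_dom.
(* [Q] has density [- l], and the drift has density [dln] times [B]. *)
exists (fun t => - l t - dln t *: B t); last first.
  case: Al => N [mN N0 AN]; exists N; split => //.
  apply: subset_trans AN => t /= nt At; apply: nt => t01.
  by exists (l t); [exact: At|rewrite Bint// opprD !opprK].
split=> [i|t t01].
  have -> : (fun s => ((- l s - dln s *: B s) 0 i)%:E) =
      ((-%E \o (EFin \o (fun s => (l s 0 i)%R))) \-
       (EFin \o (fun s => (dln s * B s 0 i)%R)))%E.
    by apply/funext => s; rewrite !mxE EFinB.
  apply: integrableB; [exact: measurable_itv| |exact: (dlnB_integrable i)].
  by apply: integrableN; exact: (il i).
rewrite /= Q0 D0 subr0 Ql// -addrA; congr (_ + _); apply/rowP => i.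
rewrite 2!mxE [in X in _ + X]mxE drift_density// !mxE.
have sub := @sub01 false t t01.
have it f : nu.-integrable `[0, 1]%classic (EFin \o f) ->
    nu.-integrable `]0, t]%classic (EFin \o f).
  by apply: integrableS => //; exact: measurable_itv.
have i1 := it (fun s => l s 0 i) (il i).
have i2 := it (fun s => dln s * B s 0 i) (dlnB_integrable i).
rewrite -opprD -RintegralD//.
have i12 : nu.-integrable `]0, t]%classic
    (EFin \o (fun s => l s 0 i + dln s * B s 0 i)).
  rewrite (_ : _ \o _ = ((EFin \o (fun s => (l s 0 i)%R)) \+
    (EFin \o (fun s => (dln s * B s 0 i)%R)))%E)//.
  by apply: integrableD => //; exact: measurable_itv.
rewrite -mulN1r -RintegralZl//.
by apply: eq_Rintegral => s _; rewrite !mxE mulN1r opprD.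
Qed.

End limit_solution.

(** * Extraction of a uniformly convergent subsequence of approximate solutions *)

Section compactness.
Context {R : realType} {d : nat}.
Local Notation E := 'rV[R]_d.
Implicit Types s t : R.
Variables (A : R -> E -> set E) (r : R -> R) (M : R) (b : R -> E -> E) (y0 : E).
Hypothesis r_rc : forall t : R, t \in `[0, 1[ -> r x @[x --> t^'+] --> r t.
Hypothesis r_nd : {in `[0, 1] &, {homo r : s t / s <= t}}.
Hypothesis r0 : r 0 = 0.
Hypothesis M_ge0 : 0 <= M.
Hypothesis b_bnd : forall t x, t \in `[0, 1] -> enorm (b t x) <= M.

Local Notation lambda := (@lebesgue_measure R).
Local Notation nu := (nu r_nd r_rc).
Local Notation phi := (clock r).
Local Notation approx := (approx_solution A b y0 r_rc r_nd).

(** Serves to reindex along the subsequence: as [j <= u j], the member of rank [u j] keeps the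
    precision required at rank [j]. *)
Lemma approx_solution_le eps eps' C Bb Yb Qb Yt ab th : 0 <= C -> eps <= eps' ->
  approx eps C Bb Yb Qb Yt ab th -> approx eps' C Bb Yb Qb Yt ab th.
Proof.
move=> C0 ee' [mB ma mb Ag aC BC QC Beq Deq Qeq YK].
have Ce : C * eps <= C * eps' by rewrite ler_wpM2l.
split=> //.
- move=> s s01; have [? ? h ?] := Ag s s01; split => //.
  by rewrite (le_trans h)// lerD2l.
- by move=> t t01; exact: le_trans (Beq t t01) Ce.
- by move=> t t01; exact: le_trans (Deq t t01) Ce.
- by move=> t t01; exact: le_trans (Qeq t t01) Ce.
- by move=> s s01; rewrite (le_trans (YK s s01))// ler_wpM2l// lerD2l.
Qed.

(** Both functions are primitives up to [C eps]. The two errors give [2 C]; the increments of the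
    primitives give [d M] for [Bb] and [d C] for [Qb]. *)
Lemma approx_solution_increment eps C Bb Yb Qb Yt ab th s t : 0 <= C -> 0 <= eps ->
  approx eps C Bb Yb Qb Yt ab th -> 0 <= s -> s <= t -> t <= 1 ->
  let K := 2 * C + d%:R * M + d%:R * C in
  enorm (Bb t - Bb s) <= K * (phi t - phi s + eps) /\
  enorm (Qb t - Qb s) <= K * (phi t - phi s + eps).
Proof.
move=> C0 eps0 ap s0 st t1 K.
have inc := phi_increase r_nd s0 st t1.
have dM0 : 0 <= d%:R * M by rewrite mulr_ge0.
have dC0 : 0 <= d%:R * C by rewrite mulr_ge0.
have s01 : s \in `[0, 1] by rewrite in_itv/= s0 (le_trans st).
have t01 : t \in `[0, 1] by rewrite in_itv/= t1 (le_trans s0).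
have inc0 : 0 <= phi t - phi s by lra.
have Kle k x : 0 <= k -> k <= d%:R * M + d%:R * C -> x <= phi t - phi s ->
    C * eps + k * x + C * eps <= K * (phi t - phi s + eps).
  move=> k0 kK xphi; have := ler_wpM2l k0 xphi.
  have := ler_wpM2r inc0 kK.
  have : 0 <= C * (phi t - phi s) by rewrite mulr_ge0.
  have : 0 <= d%:R * M * eps by rewrite mulr_ge0.
  have : 0 <= d%:R * C * eps by rewrite mulr_ge0.
  by rewrite /K; lra.
split.
- pose V x := vintegral lambda `[0, x[%classic (fun s => b s (Bb s + Yb s)).
  have lebI x y : 0 <= x -> x <= y -> y <= 1 -> lambda `[x, y[%classic = (y - x)%:E.
    by move=> _ xy _; exact: lebesgue_measure_itvco.
  have bM x : x \in `[0, 1] -> enorm (b x (Bb x + Yb x)) <= M by exact: b_bnd.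
  have VK : enorm (V t - V s) <= d%:R * M * (t - s).
    have add := @vintegral_additive R d lambda true id lebI _ M (ap_bmeas ap) bM 0 s t
      (lexx 0) s0 st t1.
    rewrite /V [X in enorm (X - _)]add addrAC subrr add0r -mulrA.
    exact: (@enorm_vintegral_itv_le R d lambda true id lebI _ M (ap_bmeas ap) bM).
  have -> : Bb t - Bb s = (Bb t - V t) + (V t - V s) - (Bb s - V s).
    by apply/rowP => i; rewrite !mxE; ring.
  apply: (le_trans (ler_enormB _ _)); apply: le_trans _ (Kle _ _ dM0 _ inc).
    apply: lerD; last exact: (ap_Beq ap s01).
    by apply: (le_trans (ler_enormD _ _)); apply: lerD; first exact: (ap_Beq ap t01).
  by rewrite lerDl.
- pose V x := vintegral nu `]0, x]%classic ab.
  have nuI x y : 0 <= x -> x <= y -> y <= 1 -> nu `]x, y]%classic = (phi y - phi x)%:E.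
    exact: nu_itvoc.
  have ma : vmeasurable `[0, 1]%classic ab.
    by move=> i; apply: measurable_funTS; exact: (ap_ameas ap i).
  have aC x : x \in `[0, 1] -> enorm (ab x) <= C by move=> _; exact: (ap_a ap).
  have VK : enorm (V s - V t) <= d%:R * C * (phi t - phi s).
    have add := @vintegral_additive R d nu false phi nuI _ C ma aC 0 s t
      (lexx 0) s0 st t1.
    rewrite enormBC /V [X in enorm (X - _)]add addrAC subrr add0r -mulrA.
    exact: (@enorm_vintegral_itv_le R d nu false phi nuI _ C ma aC).
  have -> : Qb t - Qb s = (y0 - Qb s - V s) + (V s - V t) - (y0 - Qb t - V t).
    by apply/rowP => i; rewrite !mxE; ring.
  apply: (le_trans (ler_enormB _ _)); apply: le_trans _ (Kle _ _ dC0 _ (lexx _)).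
    apply: lerD; last exact: (ap_Qeq ap t01).
    by apply: (le_trans (ler_enormD _ _)); apply: lerD; first exact: (ap_Qeq ap s01).
  by rewrite lerDr.
Qed.

Lemma approx_solution_cvg C : 0 <= C ->
  (forall eps, 0 < eps -> exists Bb Yb Qb Yt ab th, approx eps C Bb Yb Qb Yt ab th) ->
  exists (Bb Yb Qb Yt ab : nat -> R -> E) (th : nat -> R -> R) (B Q : R -> E) K,
  [/\ forall j, approx j.+1%:R^-1 C (Bb j) (Yb j) (Qb j) (Yt j) (ab j) (th j),
      forall j t, t \in `[0, 1] -> enorm (Bb j t - B t) <= d%:R * j.+1%:R^-1,
      forall j t, t \in `[0, 1] -> enorm (Qb j t - Q t) <= d%:R * j.+1%:R^-1,
      forall s t, 0 <= s -> s <= t -> t <= 1 ->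
        enorm (B t - B s) <= K * (phi t - phi s) &
      forall s t, 0 <= s -> s <= t -> t <= 1 ->
        enorm (Q t - Q s) <= K * (phi t - phi s)].
Proof.
move=> C0 apP.
have inv0 n : 0 < n.+1%:R^-1 :> R by rewrite invr_gt0.
have /choice[F FP] : forall n, exists F : (R -> E) * (R -> E) * (R -> E) * (R -> E) *
    (R -> E) * (R -> R),
    approx n.+1%:R^-1 C F.1.1.1.1.1 F.1.1.1.1.2 F.1.1.1.2 F.1.1.2 F.1.2 F.2.
  move=> n; have [Bb [Yb [Qb [Yt [ab [th ap]]]]]] := apP _ (inv0 n).
  by exists (Bb, Yb, Qb, Yt, ab, th).
pose K := 2 * C + d%:R * M + d%:R * C.
have K0 : 0 <= K by rewrite !addr_ge0// mulr_ge0.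
(* All coordinates of [Bb] ([true]) and [Qb] ([false]) form one finite family, so that a single
   subsequence serves them all. *)
pose f n (p : bool * 'I_d) t :=
  if p.1 then (F n).1.1.1.1.1 t 0 p.2 else (F n).1.1.1.2 t 0 p.2.
have fC n p t : `|f n p t| <= C.
  rewrite /f; case: p.1; apply: (le_trans (coord_le_enorm _ _)).
    exact: (ap_B (FP n)).
  exact: (ap_Q (FP n)).
have phind : {in `[0, 1] &, {homo phi : s t / s <= t}}.
  move=> s t; rewrite !in_itv/= => /andP[s0 _] /andP[_ t1] st; exact: phi_nd.
have gridP e : 0 < e -> exists N (p : nat -> R), grid phi e N p.
  by move=> e0; exact: grid_exists e0 (phi0 r0) phind (phi_rc r_rc).
have coordB (x y : E) i : x 0 i - y 0 i = (x - y) 0 i by rewrite !mxE.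
have fK n p s t : 0 <= s -> s <= t -> t <= 1 ->
    `|f n p t - f n p s| <= K * (phi t - phi s + n.+1%:R^-1).
  move=> s0 st t1.
  have [hB hQ] := approx_solution_increment C0 (ltW (inv0 n)) (FP n) s0 st t1.
  by rewrite /f; case: p.1; rewrite coordB (le_trans (coord_le_enorm _ _)).
have [g [u [ju ug gK]]] := uniform_subsequence K0 fC gridP fK.
exists (fun j => (F (u j)).1.1.1.1.1), (fun j => (F (u j)).1.1.1.1.2),
  (fun j => (F (u j)).1.1.1.2), (fun j => (F (u j)).1.1.2), (fun j => (F (u j)).1.2),
  (fun j => (F (u j)).2), (fun t => \row_i g (true, i) t),
  (fun t => \row_i g (false, i) t), (d%:R * K).
split.
- move=> j; apply: approx_solution_le (FP (u j)) => //.
  by rewrite lef_pV2 ?posrE// ler_nat ltnS.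
- move=> j t; rewrite in_itv/= => t01; apply: enorm_le_coord => i.
  by rewrite !mxE; exact: (ug j (true, i) t t01).
- move=> j t; rewrite in_itv/= => t01; apply: enorm_le_coord => i.
  by rewrite !mxE; exact: (ug j (false, i) t t01).
- move=> s t s0 st t1; rewrite -mulrA; apply: enorm_le_coord => i.
  by rewrite !mxE; exact: gK.
- move=> s t s0 st t1; rewrite -mulrA; apply: enorm_le_coord => i.
  by rewrite !mxE; exact: gK.
Qed.

End compactness.

Theorem theorem4p2 (R : realType) (d : nat)
    (A : R -> 'rV[R]_d -> set 'rV[R]_d)
    (A_maxmon : forall t, t \in `[0, 1] -> maximal_monotone (A t))
    (r : R -> R)
    (r_ge0 : forall t, t \in `[0, 1] -> 0 <= r t)
    (r_rc : forall t : R, t \in `[0, 1[ -> r x @[x --> t^'+] --> r t)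
    (r_nd : {in `[0, 1] &, {homo r : s t / s <= t}})
    (r0 : r 0 = 0)
    (dis_le : forall s t, 0 <= s -> s <= t -> t <= 1 ->
      (dis (A t) (A s) <= (r t - r s)%:E)%E)
    (c : R) (c_ge0 : 0 <= c)
    (A0_le : forall t x, t \in `[0, 1] -> dom (A t) x ->
      enorm (min_section (A t) x) <= c * (1 + enorm x))
    (b : R -> 'rV[R]_d -> 'rV[R]_d)
    (b_meas : @measurable_fun _ _
      (measurableTypeR R * borelType 'rV[R]_d)%type (borelType 'rV[R]_d)
      (`[0, 1]%classic `*` setT) (fun p => b p.1 p.2))
    (M : R) (M_ge0 : 0 <= M)
    (b_bnd : forall t x, t \in `[0, 1] -> enorm (b t x) <= M)
    (b_cont : forall t, t \in `[0, 1] -> continuous (b t))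
    (y0 : 'rV[R]_d) (y0_dom : dom (A 0) y0) :
  exists X Y : R -> 'rV[R]_d,
    let B t := vintegral lebesgue_measure `[0, t]%classic
                 (fun s => b s (X s)) in
    [/\ BVRC X /\ BVRC Y,
        X 0 = y0 /\ Y 0 = y0,
        forall t, t \in `[0, 1] -> X t = B t + Y t,
        forall t, t \in `[0, 1] -> dom (A t) (Y t) &
        exists2 dY : R -> 'rV[R]_d,
          is_density r_nd r_rc Y dY &
          {ae nu r_nd r_rc, forall t, t \in `[0, 1] ->
            exists2 a, A t (Y t) a &
              - dY t = a + dlambda_dnu r_nd r_rc t *: B t}].
Proof.
have [C [C0 apP]] := approx_solution_exists A_maxmon r_rc r_nd r0 dis_le c_ge0 A0_le
  b_meas M_ge0 b_bnd y0_dom.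
have [Bb [Yb [Qb [Yt [ab [th [B [Q [K [ap cvB cvQ BK QK]]]]]]]]]] :=
  approx_solution_cvg r0 M_ge0 b_bnd C0 apP.
exists (fun t => B t + (Q t - drift B t)), (fun t => Q t - drift B t).
exact: (limit_is_solution A_maxmon dis_le b_bnd b_cont C0 ap cvB cvQ BK QK).
Qed.
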